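(* Let $n\ge\binom{3+2}{2}=10$ and $\mathrm{char}\,\Bbbk\ne2$. A point $\mathbf{p}\in X_{3,2,n}$ is a smooth point of $X_{3,2,n}$ if and only if there exists a unique quadric $S\subseteq\mathbb{P}^3$ containing the points in $\mathbf{p}$ and one of the following holds: (1) $S$ is smooth; (2) $S$ is a quadric cone and there is at most one of the points of $\mathbf{p}$ equal to the singularity of $S$; (3) $S$ is the union of two distinct planes and there are at most three points of $\mathbf{p}$ in $S^{\mathrm{sing}}$ and they are all distinct.
   Context: $\Bbbk$ is a field, not necessarily algebraically closed; a point of a scheme means a $\Bbbk$-rational point. $X_{3,2,n}\subseteq(\mathbb{P}^3)^n$ is the closed subscheme parametrizing $n$-tuples $\mathbf{p}=(p_1,\ldots,p_n)$ of points lying on a common quadric surface, with the scheme structure defined by the vanishing of the maximal minors (of size $10$) of the $10\times n$ matrix whose $i$-th column is the vector of all degree $2$ monomials in the homogeneous coordinates of the $i$-th point. $S^{\mathrm{sing}}$ is the singular locus of $S$. The points of $\mathbf{p}$ are counted as entries of the tuple (in (2): at most one index $i$ has $p_i$ equal to the vertex). *)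

(* Defs.v *)
From HB Require Import structures.
From mathcomp Require Import all_boot all_order all_algebra.
From mathcomp Require Import ring_quotient mpoly.

Set Implicit Arguments.
Unset Strict Implicit.
Unset Printing Implicit Defensive.
Import GRing.Theory.
Local Open Scope ring_scope.

(* Points of P^m(k) are represented by nonzero row vectors of size m+1, up to
   proportionality. *)
Definition same_point (k : fieldType) (m : nat) (x y : 'rV[k]_m) : bool :=
  (x == y)%MS.

(* In this section G is a set of polynomials, defining the closed subscheme
   V(G) of affine N-space, and a is a k-rational point of V(G). *)
Section AffineSmooth.
Variables (k : fieldType) (N : nat).
Implicit Types (G : {mpoly k[N]} -> Prop) (a : 'I_N -> k).

(* Zariski tangent space (m/m^2)^* of V(G) at a, as the kernel of the Jacobian
   of the equations. *)
Definition tangent_vector G a (v : 'rV[k]_N) : Prop :=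
  forall g, G g -> \sum_(i < N) g^`M(i).@[a] * v 0 i = 0.

Definition tangent_dim G a (d : nat) : Prop :=
  exists2 V : {vspace 'rV[k]_N},
    \dim V = d & forall v, v \in V <-> tangent_vector G a v.

(* Primes of the local ring O_{V(G),a}, i.e. of the localization of k[x]/(G) at
   the maximal ideal of a, seen as the primes of k[x] which contain G and are
   contained in the ideal of polynomials vanishing at a. *)
Definition local_prime G a (P : {pred {mpoly k[N]}}) : Prop :=
  [/\ idealr_closed P,
      prime_idealr_closed P,
      forall g, G g -> g \in P
    & forall f, f \in P -> f.@[a] = 0].

Definition local_chain G a (d : nat) : Prop :=
  exists P : nat -> {pred {mpoly k[N]}},
    (forall i, (i <= d)%N -> local_prime G a (P i)) /\
    (forall i, (i < d)%N ->
       {subset P i <= P i.+1} /\ exists2 f, f \in P i.+1 & f \notin P i).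

(* Krull dimension of O_{V(G),a}. *)
Definition local_dim G a (d : nat) : Prop :=
  local_chain G a d /\ forall e, local_chain G a e -> (e <= d)%N.

(* As a is k-rational, smoothness over k at a amounts to the regularity of the
   local ring O_{V(G),a}. *)
Definition affine_smooth_at G a : Prop :=
  exists2 d, tangent_dim G a d & local_dim G a d.

End AffineSmooth.

Definition quadratic_monomials (R : comNzRingType) (z : 'rV[R]_4) :
    10.-tuple R :=
  let x := z 0 0 in let y := z 0 1 in
  let s := z 0 2%:R in let t := z 0 3%:R in
  [tuple x * x; x * y; x * s; x * t; y * y; y * s; y * t; s * s; s * t; t * t].

Definition veronese_mx (R : comNzRingType) (n : nat) (z : 'I_n -> 'rV[R]_4) :
    'M[R]_(10, n) :=
  \matrix_(a, i) tnth (quadratic_monomials (z i)) a.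

(* All selections of 10 distinct columns are allowed, in any order: this only
   repeats minors up to sign. *)
Definition maximal_minor (R : comNzRingType) (n : nat) (z : 'I_n -> 'rV[R]_4)
    (s : 'I_10 -> 'I_n) : R :=
  \det (colsub s (veronese_mx z)).

Definition in_X32 (k : fieldType) (n : nat) (p : 'I_n -> 'rV[k]_4) : Prop :=
  forall s : 'I_10 -> 'I_n, injective s -> maximal_minor p s = 0.

Section Charts.
Variables (k : fieldType) (n : nat) (c : 'I_n -> 'I_4).

(* The chart of (P^3)^n where, for each i, the c i-th homogeneous coordinate of
   the i-th point is nonzero is an affine space of dimension n * 3. The
   coordinate mxvec_index i j on it is the quotient of the (lift (c i) j)-th and
   the (c i)-th homogeneous coordinates of the i-th point. *)
Definition in_chart (p : 'I_n -> 'rV[k]_4) : Prop :=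
  forall i, p i 0 (c i) != 0.

Definition chart_coord (p : 'I_n -> 'rV[k]_4) : 'I_(n * 3) -> k :=
  mxvec (\matrix_(i < n, j < 3) (p i 0 (lift (c i) j) / p i 0 (c i))) 0.

Definition universal_point (i : 'I_n) : 'rV[{mpoly k[n * 3]}]_4 :=
  \row_j if unlift (c i) j is Some j' then 'X_(mxvec_index i j') else 1.

Definition X32_equations (g : {mpoly k[n * 3]}) : Prop :=
  exists2 s : 'I_10 -> 'I_n, injective s & g = maximal_minor universal_point s.

End Charts.

Definition X32_smooth_at (k : fieldType) (n : nat) (p : 'I_n -> 'rV[k]_4) :
    Prop :=
  exists2 c : 'I_n -> 'I_4,
    in_chart c p & affine_smooth_at (X32_equations (k := k) c) (chart_coord c p).

(* Projective hypersurfaces are represented by nonzero forms, up to nonzero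
   scalars. *)
Definition is_quadric (k : fieldType) (m : nat) (q : {mpoly k[m]}) : Prop :=
  q \is 2.-homog /\ q != 0.

Definition same_hypersurface (k : fieldType) (m : nat) (q q' : {mpoly k[m]}) :
    Prop :=
  exists2 a : k, a != 0 & q' = a *: q.

Definition through (k : fieldType) (m n : nat) (q : {mpoly k[m]})
    (p : 'I_n -> 'rV[k]_m) : Prop :=
  forall i, q.@[p i 0] = 0.

Definition singular_point (k : fieldType) (m : nat) (q : {mpoly k[m]})
    (x : 'rV[k]_m) : bool :=
  (q.@[x 0] == 0) && [forall i : 'I_m, q^`M(i).@[x 0] == 0].

(* Smoothness is tested on points over all extensions of k, as k need not be
   algebraically closed. *)
Definition smooth_hypersurface (k : fieldType) (m : nat) (q : {mpoly k[m]}) :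
    Prop :=
  forall (K : fieldType) (iota : {rmorphism k -> K}) (x : 'rV[K]_m),
    x != 0 -> ~~ singular_point (map_mpoly iota q) x.

Definition linear_form (k : fieldType) (m : nat) (u : 'rV[k]_m) : {mpoly k[m]} :=
  \sum_(j < m) u 0 j *: 'X_j.

(* A cone over a smooth plane conic: a quadric with equation b(l0, l1, l2),
   where b defines a smooth conic and l0, l1, l2 are linearly independent linear
   forms (the rows of L), whose common zero is the vertex. *)
Definition quadric_cone (k : fieldType) (q : {mpoly k[4]}) : Prop :=
  exists (b : {mpoly k[3]}) (L : 'M[k]_(3, 4)),
    [/\ is_quadric b, smooth_hypersurface b, row_free L
      & q = b \mPo [tuple linear_form (row i L) | i < 3]].

(* The planes are defined over k. If S is only a union of two conjugate planes,
   its k-points are collinear and lie on several quadrics. *)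
Definition two_distinct_planes (k : fieldType) (q : {mpoly k[4]}) : Prop :=
  exists u v : 'rV[k]_4,
    [/\ u != 0, v != 0, ~~ same_point u v
      & q = linear_form u * linear_form v].

Definition singular_entries (k : fieldType) (m n : nat) (q : {mpoly k[m]})
    (p : 'I_n -> 'rV[k]_m) : {set 'I_n} :=
  [set i | singular_point q (p i)].

(* Main.v *)
Require Import Defs.
From HB Require Import structures.
From mathcomp Require Import all_boot all_order all_algebra.
From mathcomp Require Import ring_quotient mpoly.
From mathcomp Require Import zify ring.
From mathcomp Require Import boolp.
Set Implicit Arguments.
Unset Strict Implicit.
Unset Printing Implicit Defensive.
Import GRing.Theory.
Local Open Scope ring_scope.

(** Let V be the 10 x n matrix of quadratic monomials at the points.  The
quadrics through the points are the left kernel of V, so exactly one quadric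
passes through them when V has rank 9, and X is the locus where V drops rank.

If the rank of V is at most 8, all first derivatives of the 10-minors vanish:
the Zariski tangent space is the whole of k^(3n).  As some 10-minor is a
nonzero polynomial, the local dimension is less than 3n and X is not smooth
there.

If the rank is 9, let w be the quadric.  A first-order displacement of the
points is tangent to X when the derivatives of w along it, one for each point,
form a vector of the row space of V ([tangent_vector_rank9]).  Only the points
which are smooth on the quadric have a nonzero derivative to offer; counting
dimensions, the tangent space has dimension at least 2n + 9, with equality if
and only if the entries which are singular on the quadric impose independent
conditions on quadrics ([singular_independentP]).

The local dimension is at most 2n + 9 ([local_chain_bound_interpolant]).
Choose 9 points with independent columns.  The quadric through 9 moving points
has their 9-minors as coefficients, and each of the n - 9 remaining points p_j
contributes the equation f_j saying that it lies on this quadric.  Given a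
chain of primes containing all equations, release the remaining points one
after the other, that is, replace the smallest prime P by the prime of
relations which hold modulo P when these points become generic.  Each step
produces a strictly smaller prime, because the 9-minors, not all zero at p,
are the coefficients of f_j.  So a chain of length e yields one of length
e + (n - 9) in a polynomial ring in 3n variables.  That no chain is longer
than the number of variables is proved by counting polynomials of bounded
degree ([grows_step], [grows_bound]).

Conversely, when the singular entries impose independent conditions, they can
be taken among the 9 chosen points, and a chain of length 2n + 9 exists
([projection_chain]).  A remaining point p_j is smooth on its quadric, so some
chosen point p_i lies outside the tangent plane at p_j; the stereographic
projection from p_i parametrizes the quadric near p_j by two parameters, over
the polynomial ring in the coordinates of the 9 chosen points.  This is a
rational parametrization of X near p by 2n + 9 parameters, and freezing these
one after the other gives the chain.

So p is a smooth point if and only if the quadric is unique and its singular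
entries impose independent conditions on quadrics ([smooth_iff]).  What remains
is classical ([classification]).  A unique quadric has a nonsingular entry: a
linear form vanishing at all entries could be multiplied by any other one.
Hence its symmetric matrix has rank 2, 3 or 4; in rank 2 it splits over the
ground field, because it has a smooth rational point.  Singular points form the
vertex of a cone or the common line of two planes, and points of a line impose
independent conditions on quadrics when they are distinct and at most three. *)

(** * Growth of quotients of a polynomial ring *)
Section Growth.
Variables (k : fieldType) (N : nat).
Local Notation A := {mpoly k[N]}.

(** Primes of the polynomial ring are represented by ring morphisms to integral
domains, of which they are the kernels; [free_mod] is linear independence over
[k] modulo the kernel. *)
Definition free_mod (S : idomainType) (pi : {rmorphism A -> S}) r (g : 'I_r -> A) :=
  forall c : 'I_r -> k, pi (\sum_i c i *: g i) = 0 -> forall i, c i = 0.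

(** A lower bound of degree [e] for the Hilbert function of the quotient by the
kernel.  Binomial coefficients make the induction in [grows_step] an instance
of Pascal's rule. *)
Definition grows (S : idomainType) (pi : {rmorphism A -> S}) (e : nat) :=
  exists d, forall m, exists2 g : 'I_('C(m, e)) -> A,
    forall i, (msize (g i) <= (m * d).+1)%N & free_mod pi g.

Lemma grows0 (S : idomainType) (pi : {rmorphism A -> S}) : grows pi 0.
Proof.
exists 0%N => m; exists (fun=> 1) => [i|c].
  by rewrite msize1 muln0.
move: c; rewrite bin0 => c; rewrite big_ord_recl big_ord0 addr0.
rewrite -mul_mpolyC mulr1 => h0 i; rewrite (ord1 i).
apply/eqP; apply: contraT => nz.
have : pi ((c ord0)^-1%:MP * (c ord0)%:MP) = 0 by rewrite rmorphM h0 mulr0.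
by rewrite -mpolyCM mulVf // rmorph1 => /eqP; rewrite oner_eq0.
Qed.

Lemma msizeM_leD (p q : A) : (msize (p * q) <= msize p + msize q)%N.
Proof.
have [->|p0] := eqVneq p 0; first by rewrite mul0r msize0.
have [->|q0] := eqVneq q 0; first by rewrite mulr0 msize0.
by rewrite msizeM // leq_pred.
Qed.

(** The kernel of [pi] being prime, multiplication by [f] is injective modulo
it, and its image vanishes under [pi'].  So a family free modulo the larger
kernel can be completed by the multiples by [f] of a family free modulo the
smaller one. *)
Lemma grows_step (S S' : idomainType) (pi : {rmorphism A -> S})
    (pi' : {rmorphism A -> S'}) f e :
  (forall g, pi g = 0 -> pi' g = 0) -> pi' f = 0 -> pi f != 0 ->
  grows pi' e -> grows pi e.+1.
Proof.
move=> sub f0 fn0 [d H]; exists (maxn d (msize f)); set d' := maxn _ _.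
elim=> [|m [h hs hf]].
  by rewrite bin0n; exists (fun=> 0) => [[]|c _ []].
have [g gs gf] := H m.
rewrite binS; exists (fun i => match split i with inl i => f * h i | inr j => g j end).
  move=> i; case: (split i) => j.
    apply: leq_trans (msizeM_leD _ _) _; have := hs j.
    have : (msize f <= d')%N by rewrite leq_maxr.
    by rewrite mulSn -addnS => h1 h2; apply: leq_add.
  apply: leq_trans (gs j) _; rewrite ltnS leq_mul //.
  by rewrite leq_maxl.
move=> c; rewrite big_split_ord /=.
under eq_bigr => i _ do rewrite (unsplitK (inl i)) /= scalerAr.
under [X in _ + X]eq_bigr => i _ do rewrite (unsplitK (inr i)) /=.
rewrite -mulr_sumr => E.
have cr j : c (rshift _ j) = 0.
  apply: (gf (fun j => c (rshift _ j))).
  by move: (sub _ E); rewrite rmorphD rmorphM f0 mul0r add0r.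
have cl j : c (lshift _ j) = 0.
  apply: (hf (fun j => c (lshift _ j))).
  move: E; rewrite [X in _ + X]big1 => [|i _]; last by rewrite cr scale0r.
  by rewrite addr0 rmorphM => /eqP; rewrite mulf_eq0 (negPf fn0) => /eqP.
by move=> i; rewrite -(splitK i); case: (split i) => j; rewrite /= ?cl ?cr.
Qed.

Lemma card_bmnm D : (#|('X_{1..N < D.+1} : finType)| <= D.+1 ^ N)%N.
Proof.
rewrite -[X in (_ <= X ^ _)%N]card_ord -[X in (_ <= _ ^ X)%N]card_ord -card_ffun.
pose F (m : 'X_{1..N < D.+1}) : {ffun 'I_N -> 'I_D.+1} := [ffun i => inord (m i)].
apply: (@leq_card _ _ F) => m1 m2 /ffunP E.
apply/val_inj/mnmP => i; have := E i; rewrite !ffunE => /(congr1 val) /=.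
have lt (m : 'X_{1..N < D.+1}) : (m i < D.+1)%N.
  by apply: leq_ltn_trans (bmdeg m); rewrite mdegE (bigD1 i) //= leq_addr.
by rewrite !inordK.
Qed.

Lemma free_mod_bound (S : idomainType) (pi : {rmorphism A -> S}) r (g : 'I_r -> A) D :
  (forall i, (msize (g i) <= D.+1)%N) -> free_mod pi g -> (r <= D.+1 ^ N)%N.
Proof.
move=> gs gf; apply: leq_trans (card_bmnm D).
pose T : finType := 'X_{1..N < D.+1}; rewrite -/T; pose M := \matrix_(i < r, j < #|T|) (g i)@_(enum_val j : 'X_{1..N < D.+1}).
suff /eqP <- : row_free M by exact: rank_leq_col.
rewrite -kermx_eq0; apply/eqP/row_matrixP => i; rewrite row0.
set u := row i _.
have uM : u *m M = 0 by apply/sub_kermxP; exact: row_sub.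
apply/rowP => j; rewrite [RHS]mxE.
apply: (gf (fun l => u 0 l)); rewrite -[RHS](rmorph0 pi); congr (pi _).
apply/mpolyP => m; rewrite mcoeff0 raddf_sum /=.
case: (ltnP (mdeg m) D.+1) => hm.
  move/rowP/(_ (enum_rank (BMultinom hm))): uM; rewrite [RHS]mxE mxE => E; rewrite -[RHS]E.
  by apply: eq_bigr => l _; rewrite mcoeffZ [M _ _]mxE enum_rankK.
rewrite big1 // => l _; rewrite mcoeffZ [_@__]memN_msupp_eq0 ?mulr0 //.
by apply: msize_mdeg_ge; apply: leq_trans (gs l) hm.
Qed.

(** There are only polynomially many monomials of bounded degree, with exponent
the number [N] of variables; this is Krull's bound for the dimension of a
polynomial ring. *)
Lemma grows_bound (S : idomainType) (pi : {rmorphism A -> S}) e :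
  grows pi e -> (e <= N)%N.
Proof.
move=> [d H]; rewrite leqNgt; apply/negP => lt.
(* At [m = x + e - 1] the lower bound is at least [x ^ e / e!], while the upper
   bound is at most [(e d + 1) ^ N * x ^ N]: [C] is the value beyond which the
   larger exponent wins. *)
pose C := (e`! * (e * d).+1 ^ N)%N; pose x := C.+1.
have [g gs gf] := H (x + e.-1)%N.
have le := free_mod_bound gs gf.
have l1 : (x ^ e <= 'C(x + e.-1, e) * e`!)%N.
  rewrite bin_ffact.
  have -> : (x + e.-1)%N = (C + e)%N by rewrite /x; lia.
  elim: (e) => // e' IH.
  by rewrite addnS ffactnS expnS /= leq_mul // /x; lia.
have l2 : (((x + e.-1) * d).+1 ^ N <= x ^ N * (e * d).+1 ^ N)%N.
  rewrite -expnMn; case: (N) => // N'; rewrite leq_exp2r //.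
  have : (x + e.-1 <= x * e)%N by rewrite /x; nia.
  by move=> h; apply: (@leq_ltn_trans ((x * e) * d)%N); [rewrite leq_mul | rewrite mulnS /x; nia].
have l3 : (x ^ e <= C * x ^ N)%N.
  apply: leq_trans l1 _; apply: (@leq_trans (((x + e.-1) * d).+1 ^ N * e`!)%N).
    by rewrite leq_mul.
  by apply: leq_trans (leq_mul l2 (leqnn _)) _; rewrite /C; lia.
have l4 : (x * x ^ N <= x ^ e)%N by rewrite -expnS leq_pexp2l.
have l5 := leq_trans l4 l3.
by move: l5; rewrite leq_pmul2r ?expn_gt0 // /x ltnn.
Qed.

End Growth.

(** A commutative ring without zero divisors becomes an integral domain type
once its units and their inverses are chosen. *)
Lemma domain_units (R : comNzRingType) :
  (forall x y : R, x * y = 0 -> (x == 0) || (y == 0)) ->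
  exists (S : idomainType) (f : {rmorphism R -> S}), injective f.
Proof.
move=> dom; pose inv_of (x y : R) := y * x == 1.
pose U : pred R := fun x => `[< exists y, inv_of x y >].
pose V (x : R) := if pselect (exists y, inv_of x y) is left ex then xchoose ex else x.
have VP : {in U, left_inverse 1 V *%R}.
  move=> x /asboolP ex; rewrite /V; case: pselect => // ex'.
  exact/eqP/(xchooseP ex').
have UP : forall x y : R, y * x = 1 -> U x.
  by move=> x y xy; apply/asboolP; exists y; apply/eqP.
have Vout : {in [predC U], V =1 id}.
  by move=> x /asboolP nex; rewrite /V; case: pselect.
pose S0 : comUnitRingType := HB.pack (GRing.ComNzRing.sort R)
  (GRing.ComNzRing_hasMulInverse.Build R VP UP Vout).
pose S : idomainType := HB.pack (GRing.ComUnitRing.sort S0)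
  (GRing.ComUnitRing_isIntegral.Build S0 dom).
by exists S, (idfun : {rmorphism S -> S}).
Qed.

Lemma residue_domain (R : comNzRingType) (P : {pred R}) :
  idealr_closed P -> prime_idealr_closed P ->
  exists (S : idomainType) (pi : {rmorphism R -> S}), forall x, (x \in P) = (pi x == 0).
Proof.
move=> idP prP; pose Q : R -> bool := fun x => x \in P.
pose I : prime_idealr R := HB.pack Q (isIdealr.Build R Q idP)
  (isPrimeIdealrClosed.Build R Q prP).
have [S [f f_inj]] := domain_units (@Quotient.rquot_IdomainAxiom R I).
exists S, (f \o \pi_{ideal_quot I})%qT => x /=.
rewrite -(rmorph0 f) (inj_eq f_inj).
by rewrite -[x in LHS]subr0 [LHS](Quotient.idealrBE I x 0) rmorph0.
Qed.

(** * Quadratic forms in four variables *)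
Section Forms.
Variable R : comNzRingType.
Implicit Types (w : 'rV[R]_10) (x y : 'rV[R]_4).

(** The column of quadratic monomials, so that a quadratic form is the row [w] of
its 10 coefficients. *)
Definition qv x : 'cV[R]_10 := \col_r tnth (quadratic_monomials x) r.
Definition qform w x : R := (w *m qv x) 0 0.
Definition polar w x y : R := qform w (x + y) - qform w x - qform w y.

Lemma qform_sum w x :
  qform w x = \sum_r w 0 r * tnth (quadratic_monomials x) r.
Proof. by rewrite /qform mxE; apply: eq_bigr => r _; rewrite mxE. Qed.

Lemma qformE w x : qform w x =
  w 0 0 * (x 0 0 * x 0 0) + w 0 1 * (x 0 0 * x 0 1) + w 0 2%:R * (x 0 0 * x 0 2%:R)
  + w 0 3%:R * (x 0 0 * x 0 3%:R) + w 0 4%:R * (x 0 1 * x 0 1)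
  + w 0 5%:R * (x 0 1 * x 0 2%:R) + w 0 6%:R * (x 0 1 * x 0 3%:R)
  + w 0 7%:R * (x 0 2%:R * x 0 2%:R) + w 0 8%:R * (x 0 2%:R * x 0 3%:R)
  + w 0 9%:R * (x 0 3%:R * x 0 3%:R).
Proof.
rewrite qform_sum !big_ord_recl big_ord0 addr0 !addrA /tnth /=.
by do !congr (_ + _); congr (w _ _ * _); apply: val_inj.
Qed.

Lemma qform_comb w a b x y :
  qform w (a *: x + b *: y) =
    a ^+ 2 * qform w x + a * b * polar w x y + b ^+ 2 * qform w y.
Proof. rewrite /polar !qformE !mxE; ring. Qed.

Lemma qformZ w a x : qform w (a *: x) = a ^+ 2 * qform w x.
Proof. rewrite !qformE !mxE; ring. Qed.

Lemma qvZ a x : qv (a *: x) = a ^+ 2 *: qv x.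
Proof.
apply/colP => r; rewrite !mxE; case: r => r lt.
by do 10?[case: r lt => [|r] lt; first by rewrite /tnth /= !mxE; ring].
Qed.

Lemma polarC w x y : polar w x y = polar w y x.
Proof. by rewrite /polar addrC [y + x]addrC; ring. Qed.

Lemma polarDr w x y z : polar w x (y + z) = polar w x y + polar w x z.
Proof. rewrite /polar !qformE !mxE; ring. Qed.

Lemma polarZr w x a y : polar w x (a *: y) = a * polar w x y.
Proof. rewrite /polar !qformE !mxE; ring. Qed.

Lemma polar0r w x : polar w x 0 = 0.
Proof. by rewrite -(scale0r 0) polarZr mul0r. Qed.

Lemma polar_sumr w x I (s : seq I) (F : I -> 'rV[R]_4) :
  polar w x (\sum_(i <- s) F i) = \sum_(i <- s) polar w x (F i).
Proof.
elim: s => [|i s IH]; first by rewrite !big_nil polar0r.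
by rewrite !big_cons polarDr IH.
Qed.

Lemma polarxx w x : polar w x x = qform w x *+ 2.
Proof. rewrite /polar !qformE !mxE; ring. Qed.

Lemma qformDl w w' x : qform (w + w') x = qform w x + qform w' x.
Proof. by rewrite /qform mulmxDl mxE. Qed.
Lemma qformZl a w x : qform (a *: w) x = a * qform w x.
Proof. by rewrite /qform -scalemxAl mxE. Qed.
Lemma qform0l x : qform 0 x = 0.
Proof. by rewrite /qform mul0mx mxE. Qed.

(** The coefficients of a quadratic form are recovered from its values at the
basis vectors and at their pairwise sums. *)
Lemma qform_ext0 w : (forall x, qform w x = 0) -> w = 0.
Proof.
move=> h; pose e (a : 'I_4) : 'rV[R]_4 := delta_mx 0 a.
have ha a := h (e a); have hab a b := h (e a + e b).
have w0 := ha 0; have w4 := ha 1; have w7 := ha 2%:R; have w9 := ha 3%:R.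
have w1 := hab 0 1; have w2 := hab 0 2%:R; have w3 := hab 0 3%:R.
have w5 := hab 1 2%:R; have w6 := hab 1 3%:R; have w8 := hab 2%:R 3%:R.
clear h ha hab.
move: w0 w4 w7 w9 w1 w2 w3 w5 w6 w8; rewrite !qformE !mxE /= /e.
rewrite !(mulr0, mul0r, mulr1, addr0, add0r).
move=> w0 w4 w7 w9; rewrite w0 w4 w7 w9 !(addr0, add0r) => w1 w2 w3 w5 w6 w8.
apply/rowP => r; rewrite mxE; case: r => r lt.
have -> : Ordinal lt = r%:R by apply: val_inj; rewrite /= Zp_nat /= modn_small.
by do 10?[case: r lt => [|r] lt //].
Qed.

(** The affine chart suffices to test a form: applied to [e + u] and [e - u],
where [e] is the origin of the chart and [u] any direction in it, the hypothesis
makes the form vanish at [u], and then everywhere. *)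
Lemma qform_chart0 w (c : 'I_4) : GRing.rreg (2%:R : R) ->
  (forall x, x 0 c = 1 -> qform w x = 0) -> w = 0.
Proof.
move=> reg2 h; apply: qform_ext0 => v.
pose e : 'rV[R]_4 := delta_mx 0 c; pose u := v - v 0 c *: e.
have ec : e 0 c = 1 by rewrite !mxE !eqxx.
have uc : u 0 c = 0 by rewrite /u !mxE !eqxx mulr1 subrr.
have -> : v = v 0 c *: e + 1 *: u by rewrite scale1r addrC subrK.
clearbody e u.
have qe : qform w e = 0 by apply: h.
have E b : qform w (1 *: e + b *: u) = 0.
  by apply: h; rewrite !mxE ec uc mulr0 addr0 mulr1.
have E1 := E 1; have E2 := E (-1).
rewrite !qform_comb qe in E1 E2.
have qu : qform w u = 0.
  apply: reg2; rewrite mul0r.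
  by have := congr2 +%R E1 E2; rewrite addr0 => <-; ring.
have pe : polar w e u = 0 by have := E1; rewrite qu => E0; rewrite -[RHS]E0; ring.
by rewrite qform_comb qe qu pe; ring.
Qed.

End Forms.

Section Maps.
Variables (R S : comNzRingType) (f : {rmorphism R -> S}).

Lemma map_qv (x : 'rV[R]_4) : map_mx f (qv x) = qv (map_mx f x).
Proof.
apply/colP => r; rewrite !mxE; case: r => r lt.
do 10?[case: r lt => [|r] lt; first by rewrite /tnth /= rmorphM !mxE].
by case: r lt.
Qed.

Lemma map_qform w x : f (qform w x) = qform (map_mx f w) (map_mx f x).
Proof. by rewrite /qform -map_qv -map_mxM [RHS]mxE. Qed.

Lemma map_polar w x y : f (polar w x y) = polar (map_mx f w) (map_mx f x) (map_mx f y).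
Proof. by rewrite /polar !rmorphB !map_qform map_mxD. Qed.

Lemma map_veronese n (z : 'I_n -> 'rV[R]_4) :
  map_mx f (veronese_mx z) = veronese_mx (fun i => map_mx f (z i)).
Proof.
apply/matrixP => r i; have /colP/(_ r) := map_qv (z i); by rewrite !mxE.
Qed.

Lemma map_maximal_minor n (z : 'I_n -> 'rV[R]_4) s :
  f (maximal_minor z s) = maximal_minor (fun i => map_mx f (z i)) s.
Proof. by rewrite /maximal_minor -map_veronese -det_map_mx map_mxsub. Qed.
End Maps.

(** * Minors of the Veronese matrix *)
Section Minors.
Variables (R : comNzRingType) (n : nat).
Implicit Types (z : 'I_n -> 'rV[R]_4) (w : 'rV[R]_10).

Lemma left_kernelP w z :
  w *m veronese_mx z = 0 <-> forall i, qform w (z i) = 0.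
Proof.
have E i : (w *m veronese_mx z) 0 i = qform w (z i).
  by rewrite qform_sum mxE; apply: eq_bigr => r _; rewrite mxE.
split=> [h i|h]; first by rewrite -E h mxE.
by apply/rowP => i; rewrite E h mxE.
Qed.

Definition extend_sel (s : 'I_9 -> 'I_n) (j : 'I_n) (b : 'I_10) : 'I_n :=
  if unlift ord_max b is Some b' then s b' else j.

Lemma extend_sel_inj s j : injective s -> (forall b, s b != j) ->
  injective (extend_sel s j).
Proof.
move=> s_inj sj b b'; rewrite /extend_sel.
case: unliftP => [d ->|->]; case: unliftP => [d' ->|->] //.
- by move=> /s_inj ->.
- by move=> /eqP; rewrite (negPf (sj _)).
- by move=> /esym/eqP; rewrite (negPf (sj _)).
Qed.

(** The quadric through nine points: its coefficients are the signed 9-minors,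
that is, the cofactors of a tenth column. *)
Definition interpolant z (s : 'I_9 -> 'I_n) : 'rV[R]_10 :=
  \row_r ((-1) ^+ (r + 9) * \det (row' r (colsub s (veronese_mx z)))).

(** Expansion along the last column.  This is how a maximal minor becomes the
condition that a tenth point lies on the quadric through nine others. *)
Lemma minor_extend z s j :
  maximal_minor z (extend_sel s j) = qform (interpolant z s) (z j).
Proof.
rewrite /maximal_minor (expand_det_col _ ord_max) qform_sum.
apply: eq_bigr => r _; rewrite !mxE /extend_sel unlift_none mulrC; congr (_ * _).
congr (_ * \det _); apply/matrixP => a b.
by rewrite !mxE liftK.
Qed.

Lemma interpolant_sel z s b : qform (interpolant z s) (z (s b)) = 0.
Proof.
rewrite -minor_extend /maximal_minor -det_tr.
apply: (@determinant_alternate _ _ _ (lift ord_max b) ord_max).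
  by rewrite eq_sym neq_lift.
by move=> r; rewrite !mxE /extend_sel liftK unlift_none.
Qed.
End Minors.

Lemma map_interpolant (R S : comNzRingType) (f : {rmorphism R -> S}) n
    (z : 'I_n -> 'rV[R]_4) s :
  map_mx f (interpolant z s) = interpolant (fun i => map_mx f (z i)) s.
Proof.
apply/rowP => r; rewrite !mxE rmorphM rmorphXn rmorphN rmorph1; congr (_ * _).
by rewrite -det_map_mx map_row' map_mxsub map_veronese.
Qed.

Lemma minors_vanish (R : idomainType) n (z : 'I_n -> 'rV[R]_4) w s :
  w != 0 -> (forall b, qform w (z (s b)) = 0) -> maximal_minor z s = 0.
Proof.
move=> w0 h; apply/eqP/det0P; exists w => //.
have := left_kernelP w (fun b => z (s b)) => -[_ /(_ h)].
by congr (_ = 0); congr (_ *m _); apply/matrixP => r b; rewrite !mxE.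
Qed.

Section Fields.
Variables (k : fieldType).

(** If all 9-minors vanished, then for every column [h] the ten columns would have
a common nonzero left kernel.  The left kernel of the nine columns is a line,
spanned by some [u], and a column [h] not annihilated by [u] contradicts this. *)
Lemma interpolant_neq0 n (z : 'I_n -> 'rV[k]_4) s :
  \rank (colsub s (veronese_mx z)) = 9%N -> interpolant z s != 0.
Proof.
set A := colsub s _ => rA; apply/eqP => i0.
have ker_inv (h : 'cV[k]_10) : exists2 w : 'rV_10, w != 0 & w *m A = 0 /\ w *m h = 0.
  pose B : 'M_10 := \matrix_(r, b) if unlift ord_max b is Some b' then A r b' else h r 0.
  have : \det B == 0.
    rewrite (expand_det_col _ ord_max) big1 // => r _.
    move/rowP/(_ r): i0; rewrite !mxE /cofactor => E.
    rewrite -[X in _ * X = _](_ : 0 = _) ?mulr0 // -[LHS]E; congr (_ * \det _).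
    by apply/matrixP => a b; rewrite !mxE liftK !mxE.
  case/det0P => w w0 wB; exists w => //; split.
    apply/rowP => b; move/rowP/(_ (lift ord_max b)): wB; rewrite [RHS]mxE [LHS]mxE => E.
    by rewrite [RHS]mxE [LHS]mxE -[RHS]E; apply: eq_bigr => r _; rewrite [B _ _]mxE liftK.
  apply/rowP => b; move/rowP/(_ ord_max): wB; rewrite [RHS]mxE [LHS]mxE => E.
  by rewrite [RHS]mxE [LHS]mxE -[RHS]E; apply: eq_bigr => r _; rewrite [B _ _]mxE unlift_none (ord1 b).
have rk : \rank (kermx A) = 1 by rewrite mxrank_ker rA.
have /rowV0Pn[u uK u0] : kermx A != 0 by rewrite -mxrank_eq0 rk.
have [r ur] : exists r, u 0 r != 0.
  by apply/existsP; apply: contraR u0 => /existsPn h; apply/eqP/rowP => r; rewrite mxE; apply/eqP; rewrite -[_ == _]negbK h.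
have [w w0 [wA wh]] := ker_inv (delta_mx r 0).
have : (w <= u)%MS.
  have sub : (u <= kermx A)%MS by [].
  apply: submx_trans (_ : kermx A <= u)%MS; first by apply/sub_kermxP.
  by rewrite -(mxrank_leqif_sup sub) rk rank_rV u0.
case/sub_rVP => a wau; move: w0; rewrite wau.
have := congr1 (fun M : 'M_1 => M 0 0) wh.
rewrite wau -colE !mxE => /eqP; rewrite mulf_eq0 (negPf ur) orbF => /eqP ->.
by rewrite scale0r eqxx.
Qed.

(** Points are chosen one after the other, each outside some quadric through the
previous ones; [qform_chart0] provides it in the prescribed chart. *)
Lemma independent_points (c : nat -> 'I_4) m : 2%:R != 0 :> k -> (m <= 10)%N ->
  exists2 z : nat -> 'rV[k]_4, forall i, z i 0 (c i) = 1 &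
    forall u : nat -> k, \sum_(i < m) u i *: qv (z i) = 0 ->
      forall i, (i < m)%N -> u i = 0.
Proof.
move=> ch2; elim: m => [_|m IH lt].
  by exists (fun i => delta_mx 0 (c i)) => // i; rewrite mxE !eqxx.
have [z zc zf] := IH (ltnW lt).
pose B : 'M_(10, m) := \matrix_(r < 10, i < m) qv (z i) r 0.
have /rowV0Pn[w wK w0] : kermx B != 0.
  rewrite -mxrank_eq0 mxrank_ker subn_eq0 -ltnNge.
  exact: leq_ltn_trans (rank_leq_col _) lt.
have [x xc wx] : exists2 x : 'rV_4, x 0 (c m) = 1 & qform w x != 0.
  apply: contrapT => nex; move/eqP: w0; apply; apply: (@qform_chart0 _ _ (c m)).
    by move=> a b /(mulIf ch2).
  by move=> x xc; apply/eqP; apply/negP => qx; apply: nex; exists x => //; apply/negP.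
exists (fun i => if i == m then x else z i) => [i|u].
  by case: eqP => [->|].
rewrite big_ord_recr /= eqxx; under eq_bigr => i _ do rewrite (ltn_eqF (ltn_ord i)).
move=> E.
have um : u m = 0.
  have := congr1 (fun M : 'cV_10 => (w *m M) 0 0) E.
  rewrite /= mulmx0 mulmxDr mulmx_sumr [RHS]mxE [LHS]mxE summxE big1 ?add0r => [|i _].
    rewrite -scalemxAr mxE => /eqP; rewrite mulf_eq0 => /orP[/eqP//|].
    by rewrite -/(qform w x) (negPf wx).
  rewrite -scalemxAr mxE.
  have := sub_kermxP wK => /rowP/(_ i); rewrite !mxE => h.
  suff -> : (\sum_j w 0 j * qv (z i) j 0) = 0 by rewrite mulr0.
  by rewrite -[RHS]h; apply: eq_bigr => r _; rewrite [B _ _]mxE.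
move=> i; rewrite ltnS leq_eqVlt => /orP[/eqP -> //|].
by apply: zf; move: E; rewrite um scale0r addr0.
Qed.
End Fields.

(** * Points in an affine chart *)
Section ChartPoints.
Variables (n : nat) (c : 'I_n -> 'I_4).

(** The universal point of a chart, specialized to arbitrary values of the affine
coordinates; the base ring varies so that polynomial rings, fields of fractions
and the ground field are handled alike. *)
Definition chart_point (R : comNzRingType) (y : 'I_(n * 3) -> R) (i : 'I_n) : 'rV[R]_4 :=
  \row_j if unlift (c i) j is Some j' then y (mxvec_index i j') else 1.

Lemma map_chart_point (R S : comNzRingType) (f : {rmorphism R -> S}) y i :
  map_mx f (chart_point y i) = chart_point (f \o y) i.
Proof. by apply/rowP => j; rewrite !mxE; case: unlift => [j'|] //=; rewrite rmorph1. Qed.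

Lemma eq_chart_point (R : comNzRingType) (y y' : 'I_(n * 3) -> R) i :
  (forall j, y (mxvec_index i j) = y' (mxvec_index i j)) ->
  chart_point y i = chart_point y' i.
Proof. by move=> h; apply/rowP => j; rewrite !mxE; case: unlift. Qed.

Lemma chart_point_c (R : comNzRingType) (y : 'I_(n * 3) -> R) i :
  chart_point y i 0 (c i) = 1.
Proof. by rewrite mxE unlift_none. Qed.

Lemma chart_point_lift (R : comNzRingType) (y : 'I_(n * 3) -> R) i j :
  chart_point y i 0 (lift (c i) j) = y (mxvec_index i j).
Proof. by rewrite mxE liftK. Qed.

Lemma chart_pointK (k : fieldType) (z : 'I_n -> 'rV[k]_4) i :
  z i 0 (c i) != 0 ->
  chart_point (chart_coord c z) i = (z i 0 (c i))^-1 *: z i.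
Proof.
move=> zc; apply/rowP => j; rewrite !mxE; case: unliftP => [j' ->|->].
  by rewrite /chart_coord mxvecE mxE mulrC.
by rewrite mulVf.
Qed.

Lemma map_universal_point (k : fieldType) (R : comNzRingType)
    (f : {rmorphism {mpoly k[n * 3]} -> R}) i :
  map_mx f (universal_point k c i) = chart_point (fun l => f 'X_l) i.
Proof. exact: map_chart_point. Qed.

Lemma map_universal_minor (k : fieldType) (R : comNzRingType)
    (f : {rmorphism {mpoly k[n * 3]} -> R}) s :
  f (maximal_minor (universal_point k c) s) =
  maximal_minor (chart_point (fun l => f 'X_l)) s.
Proof.
rewrite map_maximal_minor; congr (maximal_minor _ _); apply/funext => i.
exact: map_universal_point.
Qed.

(** Ten independent points in the chart prevent this minor from being zero. *)
Lemma generic_minor_neq0 (k : fieldType) : 2%:R != 0 :> k -> (10 <= n)%N ->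
  exists2 s : 'I_10 -> 'I_n, injective s & maximal_minor (universal_point k c) s != 0.
Proof.
move=> ch2 hn; exists (widen_ord hn) => [i j /(congr1 val) /= /val_inj //|].
pose c' (i : nat) := if insub i is Some i' then c i' else 0.
have c'E (i : 'I_n) : c' i = c i by rewrite /c' valK.
have [z zc zf] := @independent_points k c' 10 ch2 (leqnn _).
pose y := chart_coord c (fun i => z i).
apply/eqP => /(congr1 (meval y)); rewrite rmorph0 map_universal_minor.
under [chart_point _]funext => i.
  rewrite (_ : chart_point _ i = z i); first over.
  rewrite (_ : chart_point _ i = chart_point y i).
    by rewrite chart_pointK -c'E zc ?oner_neq0 // invr1 scale1r.
  by apply: eq_chart_point => j; rewrite /= mevalXU.
rewrite /maximal_minor -det_tr => /eqP/det0P[u u0 uV].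
move/eqP: u0; apply; apply/rowP => i; rewrite mxE.
pose u' (i : nat) := if insub i is Some i' then u 0 i' else 0.
rewrite -(_ : u' i = u 0 i); last by rewrite /u' valK.
apply: (zf u') => //; apply/colP => r; rewrite summxE mxE.
move/rowP/(_ r): uV; rewrite !mxE => E; rewrite -[RHS]E.
by apply: eq_bigr => j _; rewrite !mxE /u' valK.
Qed.
End ChartPoints.

(** * Upper bounds for the local dimension *)
Section Chains.
Variables (k : fieldType) (N : nat).
Local Notation A := {mpoly k[N]}.

Lemma mpoly_rmorph_ext (S : comNzRingType) (f g : {rmorphism A -> S}) :
  (forall a, f a%:MP = g a%:MP) -> (forall i, f 'X_i = g 'X_i) -> f =1 g.
Proof.
move=> fgC fgX p; rewrite (mpolyE p) !rmorph_sum; apply: eq_bigr => m _.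
rewrite -mul_mpolyC !rmorphM fgC mpolyXE_id !rmorph_prod; congr (_ * _).
by apply: eq_bigr => i _; rewrite !rmorphXn fgX.
Qed.

(** Each inclusion of the chain raises the growth exponent by one, starting from
the largest prime. *)
Lemma local_chain_grows G (a : 'I_N -> k) e : local_chain G a e ->
  exists (S : idomainType) (pi : {rmorphism A -> S}),
    [/\ forall g, G g -> pi g = 0, forall g, pi g = 0 -> g.@[a] = 0 & grows pi e].
Proof.
move=> [P [Pprime Pchain]].
have res i : (i <= e)%N -> exists (S : idomainType) (pi : {rmorphism A -> S}),
    forall x, (x \in P i) = (pi x == 0).
  by move=> /Pprime[] ? ? _ _; apply: residue_domain.
suff H j : (j <= e)%N -> forall (S : idomainType) (pi : {rmorphism A -> S}),
    (forall x, (x \in P (e - j)%N) = (pi x == 0)) -> grows pi j.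
  have [S [pi piP]] := res 0%N (leq0n e); have [_ _ PG Pa] := Pprime 0%N (leq0n e).
  exists S, pi; split=> [g /PG|g /eqP|]; rewrite -?piP ?piP; first by move/eqP.
    by rewrite -piP => /Pa.
  by apply: (H e) => // x; rewrite subnn piP.
elim: j => [_ S pi _|j IH lt S pi piP]; first exact: grows0.
have [S' [pi' piP']] := res (e - j)%N (leq_subr _ _).
have lt' : (e - j.+1 < e)%N by lia.
have [sub [f fin fnin]] := Pchain _ lt'.
rewrite -subSn // subSS in sub fin.
apply: (@grows_step _ _ _ _ pi pi' f).
- by move=> g /eqP; rewrite -piP => /sub; rewrite piP' => /eqP.
- by apply/eqP; rewrite -piP'.
- by rewrite -piP.
- by apply: IH => //; apply: ltnW.
Qed.
End Chains.

Section Blocks.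
Variables (k : fieldType) (n : nat) (c : 'I_n -> 'I_4).
Local Notation N := (n * 3)%N.
Local Notation A := {mpoly k[N]}.

Definition block (l : 'I_N) : 'I_n :=
  (enum_val (cast_ord (esym (mxvec_cast n 3)) l)).1.

Lemma block_index i j : block (mxvec_index i j) = i.
Proof. by rewrite /block /mxvec_index cast_ordK enum_rankK. Qed.

Variables (S : idomainType) (pi : {rmorphism A -> S}).

(** Release the points with index in [J]: their coordinates become independent
variables over the domain [S], while the coordinates of the other points keep
their values in [S].  The kernel is a prime contained in that of [pi]. *)
Definition free_blocks (J : seq 'I_n) : {rmorphism A -> {mpoly S[N]}} :=
  mmap (@mpolyC N S \o (pi \o @mpolyC N k))
    (fun l => if block l \in J then 'X_l else (pi 'X_l)%:MP).

Lemma free_blocksC J a : free_blocks J a%:MP = (pi a%:MP)%:MP.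
Proof. by rewrite /free_blocks /= mmapC. Qed.

Lemma free_blocksX J l :
  free_blocks J 'X_l = if block l \in J then 'X_l else (pi 'X_l)%:MP.
Proof. by rewrite /free_blocks /= mmapX mmap1U. Qed.

(** Giving back to the point [j] its coordinates in [S] is a specialization. *)
Lemma free_blocks_sub J j g : free_blocks (j :: J) g = 0 -> free_blocks J g = 0.
Proof.
pose spec : {rmorphism {mpoly S[N]} -> {mpoly S[N]}} :=
  mmap (@mpolyC N S) (fun l => if block l \in J then 'X_l else (pi 'X_l)%:MP).
suff E : free_blocks J =1 spec \o free_blocks (j :: J).
  by move=> h; rewrite E /= h rmorph0.
apply: mpoly_rmorph_ext => [a|l] /=.
  by rewrite !free_blocksC /spec /= mmapC.
rewrite !free_blocksX inE; case lJ: (block l \in J).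
  by rewrite orbT /spec /= mmapX mmap1U lJ.
by rewrite orbF; case: ifP => _; rewrite /spec /= ?mmapC // mmapX mmap1U lJ.
Qed.

Lemma free_blocks_point J i : i \notin J ->
  map_mx (free_blocks J) (universal_point k c i) =
  map_mx (@mpolyC N S) (map_mx pi (universal_point k c i)).
Proof.
move=> iJ; rewrite !map_universal_point map_chart_point.
by apply: eq_chart_point => j; rewrite free_blocksX block_index (negPf iJ).
Qed.

Lemma interpolant_ext (R : comNzRingType) (z z' : 'I_n -> 'rV[R]_4) s :
  (forall b, z (s b) = z' (s b)) -> interpolant z s = interpolant z' s.
Proof.
move=> h; apply/rowP => r; rewrite !mxE; congr (_ * \det _).
by apply/matrixP => x y; rewrite !mxE h.
Qed.

(** The equation of the point [j] separates two successive primes: when only the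
points of [J] are released it still vanishes, but when [j] is released too it
becomes a quadratic polynomial in new variables, with the coefficients of the
interpolating quadric, which are not all zero. *)
Lemma grows_free_blocks (s : 'I_9 -> 'I_n) J e :
  injective s -> 2%:R != 0 :> k ->
  (forall s', injective s' -> pi (maximal_minor (universal_point k c) s') = 0) ->
  map_mx pi (interpolant (universal_point k c) s) != 0 ->
  uniq J -> (forall b, s b \notin J) -> grows pi e ->
  grows (free_blocks J) (e + size J).
Proof.
move=> s_inj ch2 pi0 nz + + gr; elim: J => [_ _|j J IH /= /andP[jJ uJ] sJ].
  rewrite addn0; case: gr => d H; exists d => m; have [g gs gf] := H m.
  exists g => // x /eqP; rewrite (_ : free_blocks [::] =1 @mpolyC N S \o pi); last first.
    by apply: mpoly_rmorph_ext => [a|l]; rewrite ?free_blocksC ?free_blocksX.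
  by rewrite /= mpolyC_eq0 => /eqP; apply: gf.
have sJ' b : s b \notin J by have := sJ b; rewrite inE negb_or => /andP[].
rewrite addnS; pose f := maximal_minor (universal_point k c) (extend_sel s j).
have sj b : s b != j by have := sJ b; rewrite inE negb_or => /andP[].
have E J' : (forall b, s b \notin J') ->
    free_blocks J' f = qform (map_mx (@mpolyC N S) (map_mx pi (interpolant (universal_point k c) s)))
      (map_mx (free_blocks J') (universal_point k c j)).
  move=> sJ1; rewrite /f map_maximal_minor minor_extend; congr (qform _ _).
  rewrite !map_interpolant; apply: interpolant_ext => b.
  by rewrite free_blocks_point.
apply: (@grows_step _ _ _ _ (free_blocks (j :: J)) (free_blocks J) f).
- exact: free_blocks_sub.
- rewrite (E _ sJ') free_blocks_point // -!map_qform -minor_extend.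
  by rewrite pi0 ?mpolyC0 //; apply: extend_sel_inj.
- rewrite (E _ sJ); set w := map_mx pi (interpolant _ _) in nz *; clearbody w.
  apply/eqP => q0; move/eqP: nz; apply; apply: (@qform_chart0 _ _ (c j)).
    move=> x y /mulIf; apply; rewrite -(rmorph_nat (pi \o @mpolyC N k)) fmorph_eq0.
    exact: ch2.
  move=> x xc.
  have := congr1 (meval (mxvec (\matrix_(i' < n, j' < 3) x 0 (lift (c j) j')) 0)) q0.
  rewrite rmorph0 map_qform map_universal_point map_chart_point => <-.
  congr (qform _ _); first by apply/rowP => r; rewrite !mxE /= mevalC.
  apply/rowP => i; rewrite mxE; case: unliftP => [i' ->|->] //=.
  by rewrite free_blocksX block_index mem_head mevalXU mxvecE mxE.
- by apply: IH.
Qed.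
End Blocks.

Lemma size_off_codom n (s : 'I_9 -> 'I_n) : injective s ->
  size [seq j <- enum 'I_n | j \notin codom s] = (n - 9)%N.
Proof.
move=> s_inj; have := cardC (mem (codom s)); rewrite card_codom // !card_ord => E.
rewrite -[in RHS]E addKn -(card_uniqP (filter_uniq _ (enum_uniq _))).
by apply: eq_card => j; rewrite !inE mem_filter mem_enum andbT.
Qed.

Section Bounds.
Variables (k : fieldType) (n : nat) (c : 'I_n -> 'I_4) (a : 'I_(n * 3) -> k).
Hypothesis ch2 : 2%:R != 0 :> k.

Lemma meval_universal_point i : map_mx (meval a) (universal_point k c i) = chart_point c a i.
Proof.
by rewrite map_universal_point; apply: eq_chart_point => j; rewrite /= mevalXU.
Qed.

(** The zero ideal can be put below any prime containing the equations. *)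
Lemma local_chain_bound e : (10 <= n)%N ->
  local_chain (X32_equations (k := k) c) a e -> (e < n * 3)%N.
Proof.
move=> hn /local_chain_grows[S [pi [piG _ gr]]].
have [s s_inj nz] := generic_minor_neq0 c ch2 hn.
pose f := maximal_minor (universal_point k c) s.
apply: (@grows_bound _ _ _ idfun); apply: (@grows_step _ _ _ _ idfun pi f _ _ _ nz gr).
  by move=> g /= ->; exact: rmorph0.
by apply: piG; exists s.
Qed.

(** This is the bound 2n + 9: the released points are those outside the nine
chosen ones, and the interpolating quadric, nonzero at the given point, is
nonzero modulo any prime of the local ring. *)
Lemma local_chain_bound_interpolant s e : injective s ->
  interpolant (chart_point c a) s != 0 ->
  local_chain (X32_equations (k := k) c) a e -> (e + (n - 9) <= n * 3)%N.
Proof.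
move=> s_inj nz /local_chain_grows[S [pi [piG pia gr]]].
pose J := [seq j <- enum 'I_n | j \notin codom s].
have sizeJ : size J = (n - 9)%N := size_off_codom s_inj.
rewrite -sizeJ; apply: grows_bound.
apply: (@grows_free_blocks k n c S pi s J e s_inj ch2) => //.
- by move=> s' s'_inj; apply: piG; exists s'.
- apply: contraNneq nz => w0; apply/eqP/rowP => r; rewrite [RHS]mxE.
  have /pia h : pi (interpolant (universal_point k c) s 0 r) = 0.
    by move/rowP/(_ r): w0; rewrite mxE [RHS]mxE.
  rewrite -[RHS]h (_ : interpolant (chart_point c a) s =
    map_mx (meval a) (interpolant (universal_point k c) s)) ?[LHS]mxE //.
  by rewrite map_interpolant; apply: interpolant_ext => b; rewrite meval_universal_point.
- by rewrite filter_uniq ?enum_uniq.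
- by move=> b; rewrite mem_filter codom_f.
Qed.
End Bounds.

(** * A long chain of primes from stereographic projection *)
Lemma mxvec_index_inj m n : injective (fun ij : 'I_m * 'I_n => mxvec_index ij.1 ij.2).
Proof. by move=> [i j] [i' j'] /cast_ord_inj/enum_rank_inj. Qed.

Lemma mulf_eq0_mid (R : idomainType) (x y z : R) :
  x != 0 -> z != 0 -> (x * y * z == 0) = (y == 0).
Proof. by move=> /negPf x0 /negPf z0; rewrite !mulf_eq0 x0 z0 orbF. Qed.

Section Projection.
Variables (n : nat) (c : 'I_n -> 'I_4) (s : 'I_9 -> 'I_n) (anchor : 'I_n -> 'I_n).

Definition chart_form (R : comNzRingType) (x : 'I_(n * 3) -> R) : 'rV[R]_10 :=
  interpolant (chart_point c x) s.

(** With X and v the chart points of index [anchor j] and [j], and q the quadric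
through the nine chosen points, [q(v) X - q(X, v) v] is the second intersection
of the quadric with the line joining X, which lies on it, to v.  At parameters
where v itself lies on the quadric this is v, up to the factor - q(X, v); here
q(X, v) is the polar form. *)
Definition project (R : comNzRingType) (x : 'I_(n * 3) -> R) (j : 'I_n) : 'rV[R]_4 :=
  if j \in codom s then chart_point c x j else
  qform (chart_form x) (chart_point c x j) *: chart_point c x (anchor j)
  + (- polar (chart_form x) (chart_point c x (anchor j)) (chart_point c x j))
    *: chart_point c x j.

Lemma map_chart_form (R S : comNzRingType) (f : {rmorphism R -> S}) x :
  map_mx f (chart_form x) = chart_form (f \o x).
Proof.
by rewrite /chart_form map_interpolant; apply: interpolant_ext => b; apply: map_chart_point.
Qed.

Lemma map_project (R S : comNzRingType) (f : {rmorphism R -> S}) x j :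
  map_mx f (project x j) = project (f \o x) j.
Proof.
rewrite /project; case: ifP => _; first exact: map_chart_point.
by rewrite map_mxD !map_mxZ rmorphN map_polar map_qform !map_chart_point map_chart_form.
Qed.

Lemma qform_chart_form (R : comNzRingType) (x : 'I_(n * 3) -> R) i :
  i \in codom s -> qform (chart_form x) (chart_point c x i) = 0.
Proof. by move=> /codomP[b ->]; apply: interpolant_sel. Qed.

Lemma qform_project (R : comNzRingType) (x : 'I_(n * 3) -> R) j :
  (j \notin codom s -> anchor j \in codom s) ->
  qform (chart_form x) (project x j) = 0.
Proof.
move=> anchor_s; rewrite /project; case: ifP => js; first exact: qform_chart_form.
rewrite qform_comb (@qform_chart_form _ x (anchor j)) ?anchor_s ?js //; ring.
Qed.
End Projection.

Section Param.
Variables (k : fieldType) (n : nat) (c : 'I_n -> 'I_4) (a : 'I_(n * 3) -> k).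
Local Notation N := (n * 3)%N.
Local Notation A := {mpoly k[N]}.
Local Notation K := {fraction A}.
Local Notation iota := (@tofrac A : {rmorphism A -> K}).

Section Eval.
Variables (L : fieldType) (f : {rmorphism A -> L}) (Y : 'I_n -> 'rV[A]_4).

(** The coordinate ring of the chart evaluated at points whose homogeneous
coordinates are polynomials, seen in the field [L] through [f]. *)
Definition eval_points : {rmorphism A -> L} :=
  mmap (f \o @mpolyC N k) (chart_coord c (fun i => map_mx f (Y i))).

Lemma eval_pointsC b : eval_points b%:MP = f b%:MP.
Proof. by rewrite /eval_points /= mmapC. Qed.

Lemma eval_pointsX i e : eval_points 'X_(mxvec_index i e) =
  f (Y i 0 (lift (c i) e)) / f (Y i 0 (c i)).
Proof. by rewrite /eval_points /= mmapX mmap1U /chart_coord mxvecE !mxE. Qed.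

Lemma eval_universal_point i : f (Y i 0 (c i)) != 0 ->
  map_mx eval_points (universal_point k c i) = (f (Y i 0 (c i)))^-1 *: map_mx f (Y i).
Proof.
move=> nz; rewrite map_universal_point.
have nz' : (map_mx f (Y i)) 0 (c i) != 0 by rewrite mxE.
have := @chart_pointK n c L (fun i => map_mx f (Y i)) i nz'.
rewrite /= [map_mx f (Y i) 0 _]mxE => <-.
by apply: eq_chart_point => j; rewrite /eval_points /= mmapX mmap1U.
Qed.
End Eval.

(** Relations between rational functions persist after a specialization that
does not annihilate their denominators. *)
Lemma eval_points_specialize (L : fieldType) (f : {rmorphism A -> L})
    (Y : 'I_n -> 'rV[A]_4) g :
  (forall i, f (Y i 0 (c i)) != 0) ->
  eval_points iota Y g = 0 -> eval_points f Y g = 0.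
Proof.
move=> fY.
(* [v] is a value of the rational function [u] under the partial map [f] *)
pose spec (u : K) (v : L) := exists x y : A,
  [/\ f y != 0, u = iota x / iota y & v = f x / f y].
have nz (y : A) : f y != 0 -> iota y != 0.
  by apply: contraNneq => /eqP; rewrite tofrac_eq0 => /eqP ->; rewrite rmorph0.
have specD u v u' v' : spec u v -> spec u' v' -> spec (u + u') (v + v').
  move=> [x [y [fy -> ->]]] [x' [y' [fy' -> ->]]].
  exists (x * y' + x' * y), (y * y'); split; first by rewrite rmorphM mulf_neq0.
    by rewrite addf_div ?nz // !(rmorphM, rmorphD).
  by rewrite addf_div // !(rmorphM, rmorphD).
have specM u v u' v' : spec u v -> spec u' v' -> spec (u * u') (v * v').
  move=> [x [y [fy -> ->]]] [x' [y' [fy' -> ->]]].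
  exists (x * x'), (y * y'); split; first by rewrite rmorphM mulf_neq0.
    by rewrite mulf_div !rmorphM.
  by rewrite mulf_div !rmorphM.
have specC x : spec (iota x) (f x).
  by exists x, 1; rewrite !rmorph1 oner_neq0 !divr1.
have : spec (eval_points iota Y g) (eval_points f Y g).
  rewrite /eval_points /= /mmap; apply: (big_ind2 spec _ specD) => [|m _].
    by rewrite -(rmorph0 iota) -(rmorph0 f).
  apply: (specM); first exact: specC.
  rewrite /mmap1; apply: (big_ind2 spec _ specM) => [|l _].
    by rewrite -(rmorph1 iota) -(rmorph1 f).
   elim: (m l) => [|e IH].
    by rewrite !expr0 -(rmorph1 iota) -(rmorph1 f).
  rewrite !exprS; apply: (specM) IH.
  case/mxvec_indexP: l => i j.
  rewrite /chart_coord !mxvecE !mxE.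
  by exists (Y i 0 (lift (c i) j)), (Y i 0 (c i)).
move=> [x [y [fy -> ->]]] /eqP; rewrite mulf_eq0 invr_eq0 (negPf (nz _ fy)) orbF.
by rewrite tofrac_eq0 => /eqP ->; rewrite rmorph0 mul0r.
Qed.

Variables (s : 'I_9 -> 'I_n) (anchor : 'I_n -> 'I_n).
Local Notation P := (chart_point c a).
Local Notation w := (interpolant P s).
Hypotheses (w_neq0 : w != 0) (wP : forall i, qform w (P i) = 0).
Hypothesis anchor_s : forall j, j \notin codom s -> anchor j \in codom s.
Hypothesis anchorP : forall j, j \notin codom s -> polar w (P (anchor j)) (P j) != 0.

(** The parameters in [T] are given their values at the point [a], the others
remain variables. *)
Definition freeze (T : seq 'I_N) (l : 'I_N) : A := if l \in T then (a l)%:MP else 'X_l.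
Local Notation Y T := (project c s anchor (freeze T)).
Local Notation form T := (chart_form c s (freeze T)).

Lemma meval_freeze T : meval a \o freeze T = a.
Proof.
by apply/funext => l; rewrite /= /freeze; case: ifP; rewrite ?mevalC ?mevalXU.
Qed.

Lemma meval_project T j :
  map_mx (meval a) (Y T j) =
  (if j \in codom s then 1 else - polar w (P (anchor j)) (P j)) *: P j.
Proof.
rewrite map_project meval_freeze /project; case: ifP => js; first by rewrite scale1r.
by rewrite [chart_form _ _ _](_ : _ = w) // wP scale0r add0r.
Qed.

Lemma form_neq0 T : form T != 0.
Proof.
apply: contraNneq w_neq0 => h; apply/eqP.
have := map_chart_form c s (meval a) (freeze T).
by rewrite h meval_freeze map_mx0 => /esym.
Qed.

Lemma meval_project_neq0 T j : (Y T j 0 (c j)).@[a] != 0.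
Proof.
have := congr1 (fun x : 'rV_4 => x 0 (c j)) (meval_project T j).
rewrite [LHS]mxE [RHS]mxE chart_point_c mulr1 => ->; case: ifP => js.
  exact: oner_neq0.
by rewrite oppr_eq0 anchorP ?js.
Qed.

Lemma project_neq0 T j : Y T j 0 (c j) != 0.
Proof.
by apply: contraNneq (meval_project_neq0 T j) => ->; rewrite rmorph0.
Qed.

(** The point of [X] over the field of rational functions obtained by projection,
with the parameters in [T] frozen.  Its prime of relations grows with [T]. *)
Definition ev T : {rmorphism A -> K} := eval_points iota (Y T).

Lemma ev_point T i : map_mx (ev T) (universal_point k c i) =
  (iota (Y T i 0 (c i)))^-1 *: map_mx iota (Y T i).
Proof. by apply: eval_universal_point; rewrite tofrac_eq0 project_neq0. Qed.

(** The ten points of a minor lie on a common quadric, the one through the nine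
chosen points. *)
Lemma ev_equation T g : X32_equations c g -> ev T g = 0.
Proof.
move=> [s' _ ->]; rewrite map_maximal_minor.
apply: (@minors_vanish _ _ _ (map_mx iota (form T))).
  apply: contraNneq (form_neq0 T) => /rowP h; apply/eqP/rowP => r.
  by have /eqP := h r; rewrite mxE [X in _ == X]mxE tofrac_eq0 [RHS]mxE => /eqP.
move=> b; rewrite ev_point qformZ -map_qform qform_project ?rmorph0 ?mulr0 //.
exact: anchor_s.
Qed.

(** The parametrization takes the value [a] at [a], up to the nonzero factor
recorded in [meval_project]: so all the primes lie in the ideal of [a]. *)
Lemma ev_eval T g : ev T g = 0 -> g.@[a] = 0.
Proof.
move=> /(eval_points_specialize (meval_project_neq0 T)) h.
rewrite -[RHS]h; apply: (mpoly_rmorph_ext (f := meval a)) => [b|l].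
  by rewrite eval_pointsC.
case/mxvec_indexP: l => i j.
have := eval_universal_point (meval_project_neq0 T i).
rewrite map_universal_point => /rowP/(_ (lift (c i) j)); rewrite chart_point_lift => ->.
rewrite /= mevalXU meval_project.
have := congr1 (fun x : 'rV_4 => x 0 (c i)) (meval_project T i).
rewrite [LHS]mxE [RHS]mxE chart_point_c mulr1 => E.
rewrite -E [RHS]mxE [X in _ * X]mxE chart_point_lift mulKf //.
exact: meval_project_neq0.
Qed.

Lemma ev_sub T T' g : {subset T <= T'} -> ev T g = 0 -> ev T' g = 0.
Proof.
move=> TT'.
pose sg : {rmorphism A -> A} := mmap (@mpolyC N k) (freeze T').
have sgE : sg \o freeze T = freeze T'.
  apply/funext => l; rewrite {1}/freeze /=.
  case: ifP => [/TT' lT|lT]; rewrite /sg /= ?mmapC ?mmapX ?mmap1U //.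
  by rewrite /freeze lT.
have E j : map_mx sg (Y T j) = Y T' j by rewrite map_project sgE.
have nz i : (iota \o sg) (Y T i 0 (c i)) != 0.
  have /rowP/(_ (c i)) := E i; rewrite mxE /= => ->.
  by rewrite tofrac_eq0 project_neq0.
move=> /(eval_points_specialize nz) h; rewrite -[RHS]h.
apply: mpoly_rmorph_ext => [b|l].
  apply: etrans (eval_pointsC _ _ b) _; apply: etrans (esym (eval_pointsC _ _ b)).
  by rewrite /= /sg /= mmapC.
case/mxvec_indexP: l => i e.
apply: etrans (eval_pointsX _ _ i e) _; apply: etrans (esym (eval_pointsX _ _ i e)).
have Ei d : iota (Y T' i 0 d) = (iota \o sg) (Y T i 0 d) by rewrite -E mxE.
by rewrite !Ei.
Qed.

(** Chosen points are parametrized by their own coordinates. *)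
Lemma ev_coord_test T i (e : 'I_3) : i \in codom s ->
  (ev T ('X_(mxvec_index i e) - (a (mxvec_index i e))%:MP) == 0) = (mxvec_index i e \in T).
Proof.
move=> i_s; rewrite rmorphB.
have -> : ev T 'X_(mxvec_index i e) = iota (freeze T (mxvec_index i e)).
  apply: etrans (eval_pointsX _ _ i e) _.
  by rewrite /project i_s chart_point_c chart_point_lift rmorph1 divr1.
have -> : ev T (a (mxvec_index i e))%:MP = iota (a (mxvec_index i e))%:MP.
  exact: eval_pointsC.
rewrite -rmorphB tofrac_eq0 /freeze.
case: ifP => // _; first by rewrite subrr eqxx.
apply/negP => /eqP/(congr1 (meval (fun=> a (mxvec_index i e) + 1))) /eqP.
by rewrite rmorphB /= mevalXU mevalC rmorph0 addrC addKr oner_eq0.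
Qed.

Section Pencil.
Variable j : 'I_n.
Hypothesis js : j \notin codom s.
Let i := anchor j.

(** The equation of the plane where the affine coordinate [e] has the value [b]. *)
Definition plane (R : comNzRingType) (b : R) (e : 'I_3) (x : 'rV[R]_4) : R :=
  x 0 (lift (c j) e) - b * x 0 (c j).

Lemma plane_comb (R : comNzRingType) (b : R) e u x v y :
  plane b e (u *: x + v *: y) = u * plane b e x + v * plane b e y.
Proof. rewrite /plane !mxE; ring. Qed.

Lemma planeZ (R : comNzRingType) (b : R) e u x : plane b e (u *: x) = u * plane b e x.
Proof. rewrite /plane !mxE; ring. Qed.

Lemma map_plane (R S : comNzRingType) (f : {rmorphism R -> S}) b e x :
  f (plane b e x) = plane (f b) e (map_mx f x).
Proof. by rewrite /plane !mxE rmorphB rmorphM. Qed.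

(** The equation saying that the line through [x] and [y] meets the line which is
the intersection of two of these planes.  Up to a factor it depends on [y] only
through its line with [x], which does not change when [y] is projected from
[x]. *)
Definition pencil (R : comNzRingType) (b b' : R) e e' (x y : 'rV[R]_4) : R :=
  plane b e x * plane b' e' y - plane b e y * plane b' e' x.

Lemma pencilZr (R : comNzRingType) (b b' : R) e e' u x y :
  pencil b b' e e' x (u *: y) = u * pencil b b' e e' x y.
Proof. rewrite /pencil !planeZ; ring. Qed.

Lemma pencil_comb (R : comNzRingType) (b b' : R) e e' u v x y :
  plane b' e' y = 0 ->
  pencil b b' e e' x (u *: x + (- v) *: y) = v * plane b e y * plane b' e' x.
Proof. by move=> y0; rewrite /pencil !plane_comb y0; ring. Qed.

Lemma map_pencil (R S : comNzRingType) (f : {rmorphism R -> S}) b b' e e' x y :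
  f (pencil b b' e e' x y) = pencil (f b) (f b') e e' (map_mx f x) (map_mx f y).
Proof. by rewrite /pencil rmorphB !rmorphM !map_plane. Qed.

Let b e : A := (a (mxvec_index j e))%:MP.
(** The plane with index [ord_max] always contains the parameter point [v], as its
third coordinate is frozen.  So this vanishes when the coordinate [e] of [v] is
frozen too. *)
Definition pencil_test e : A :=
  pencil (b e) (b ord_max) e ord_max (universal_point k c i) (universal_point k c j).

Lemma plane_frozen T e :
  plane (b e) e (chart_point c (freeze T) j) = freeze T (mxvec_index j e) - b e.
Proof. by rewrite /plane chart_point_c chart_point_lift mulr1. Qed.

Lemma plane_generic_neq0 T e : (forall d, mxvec_index i d \notin T) ->
  plane (b e) e (chart_point c (freeze T) i) != 0.
Proof.
move=> iT; pose x : 'rV[k]_4 := delta_mx 0 (c i).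
suff [y yc pl] : exists2 y : 'rV[k]_4, y 0 (c i) = 1 & plane (a (mxvec_index j e)) e y != 0.
  apply/eqP => /(congr1 (meval (chart_coord c (fun=> y)))) /eqP.
  rewrite rmorph0 map_plane map_chart_point /b /= mevalC.
  rewrite [chart_point _ _ _](_ : _ = y) ?(negPf pl) //.
  rewrite -[RHS](scale1r y) -[in RHS](invr1) -yc -(@chart_pointK n c k (fun=> y)) ?yc ?oner_neq0 //.
  by apply: eq_chart_point => d; rewrite /= /freeze (negPf (iT _)) mevalXU.
have xc : x 0 (c i) = 1 by rewrite mxE !eqxx.
have [p0|p1] := eqVneq (plane (a (mxvec_index j e)) e x) 0; last by exists x.
pose y : 'rV[k]_4 := delta_mx 0 (lift (c j) e).
have [E|ne] := eqVneq (lift (c j) e) (c i).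
  have xj : x 0 (c j) = 0 by rewrite mxE -E (negPf (neq_lift _ _)).
  by move/eqP: p0; rewrite /plane E xc xj mulr0 subr0 oner_eq0.
exists (1 *: x + 1 *: y).
  by rewrite !mxE !eqxx eq_sym (negPf ne) /= mulr1 mulr0 addr0.
have yj : y 0 (c j) = 0 by rewrite mxE (negPf (neq_lift _ _)).
by rewrite plane_comb p0 mulr0 add0r mul1r /plane yj mulr0 subr0 mxE !eqxx oner_neq0.
Qed.

Lemma ev_pencil_test T e : mxvec_index j ord_max \in T ->
  (forall d, mxvec_index i d \notin T) ->
  (ev T (pencil_test e) == 0) = (mxvec_index j e \in T).
Proof.
move=> jT iT; rewrite map_pencil !eval_pointsC.
have i_s : i \in codom s by apply: anchor_s.
have -> : map_mx (ev T) (universal_point k c i) = map_mx iota (chart_point c (freeze T) i).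
  by rewrite ev_point /project i_s chart_point_c rmorph1 invr1 scale1r.
rewrite ev_point; set u := (iota _)^-1.
have u0 : u != 0 by rewrite invr_eq0 tofrac_eq0 project_neq0.
rewrite pencilZr -map_pencil.
rewrite mulf_eq0 (negPf u0) tofrac_eq0 /= /project (negPf js).
set p := polar _ _ _; set q := qform _ _; set X := chart_point _ _ _; set v := chart_point _ _ _.
rewrite pencil_comb; last by rewrite plane_frozen /freeze jT subrr.
have p0 : p != 0.
  apply/eqP => /(congr1 (meval a))/eqP.
  rewrite rmorph0 map_polar map_chart_form !map_chart_point meval_freeze.
  by rewrite (negPf (anchorP js)).
have := plane_generic_neq0 ord_max iT; rewrite -/X => X0.
rewrite (mulf_eq0_mid _ p0 X0).
rewrite plane_frozen /freeze; case: ifP => _; first by rewrite subrr eqxx.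
apply/negP => /eqP/(congr1 (meval (fun=> a (mxvec_index j e) + 1))) /eqP.
by rewrite rmorphB /= mevalXU mevalC rmorph0 addrC addKr oner_eq0.
Qed.
End Pencil.

(** The third coordinate of a remaining point is frozen from the beginning ([E0]),
for the quadric has only two parameters.  The parameters are then frozen in the
order [L1], [L2]: [pencil_test] is a valid test only as long as the points
projected from are generic. *)
Let J := [seq j <- enum 'I_n | j \notin codom s].
Let E0 := [seq mxvec_index j (ord_max : 'I_3) | j <- J].
Let L1 := [seq mxvec_index j e | j <- J, e <- [:: 0; 1 : 'I_3]].
Let L2 := [seq mxvec_index i e | i <- codom s, e <- enum 'I_3].

Lemma mem_off_codom j : (j \in J) = (j \notin codom s).
Proof. by rewrite mem_filter mem_enum andbT. Qed.

Lemma mxvec_index_eq m p (i i' : 'I_m) (e e' : 'I_p) :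
  (mxvec_index i e == mxvec_index i' e') = (i == i') && (e == e').
Proof. exact: (inj_eq (@mxvec_index_inj m p) (i, e) (i', e')). Qed.

Lemma mem_outer_coordinates i e : i \in codom s -> mxvec_index i e \notin E0 ++ L1.
Proof.
move=> i_s; rewrite mem_cat negb_or; apply/andP; split.
  apply/mapP => -[j jJ] /eqP; rewrite mxvec_index_eq => /andP[/eqP E _].
  by move: jJ; rewrite mem_off_codom -E i_s.
apply/allpairsP => -[[j e'] /= [jJ _]] /eqP; rewrite mxvec_index_eq => /andP[/eqP E _].
by move: jJ; rewrite mem_off_codom -E i_s.
Qed.

Lemma uniq_coordinates : injective s -> uniq (E0 ++ L1 ++ L2).
Proof.
move=> s_inj; have uJ : uniq J by rewrite filter_uniq ?enum_uniq.
rewrite catA cat_uniq cat_uniq; apply/and3P; split; first (apply/and3P; split).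
- rewrite map_inj_uniq // => x y /eqP; rewrite mxvec_index_eq => /andP[/eqP //].
- apply/hasPn => l /allpairsP[[j e] /= [_ he ->]]; apply/mapP => -[j' _] /eqP.
  by rewrite mxvec_index_eq => /andP[_ /eqP E]; move: he; rewrite E.
- apply: allpairs_uniq => // -[i e] [i' e'] _ _ /eqP.
  by rewrite /= mxvec_index_eq => /andP[/eqP -> /eqP ->].
- apply/hasPn => l /allpairsP[[i e] /= [i_s _ ->]]; exact: mem_outer_coordinates.
- apply: allpairs_uniq.
  + exact/injectiveP.
  + exact: enum_uniq.
  move=> [i e] [i' e'] _ _ /eqP.
  by rewrite /= mxvec_index_eq => /andP[/eqP -> /eqP ->].
Qed.

Lemma projection_chain : injective s ->
  local_chain (X32_equations (k := k) c) a (size (L1 ++ L2)).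
Proof.
move=> s_inj; set L := L1 ++ L2; pose T m := E0 ++ take m L.
pose Q m : {pred A} := fun g => ev (T m) g == 0.
have QE m g : (g \in Q m) = (ev (T m) g == 0) by [].
exists Q; split=> [m _|m lt].
  split.
  - split; rewrite ?QE ?rmorph0 ?rmorph1 ?oner_neq0 // => x u v.
    by rewrite !QE rmorphD rmorphM => /eqP -> /eqP ->; rewrite mulr0 addr0.
  - by move=> u v; rewrite !QE rmorphM mulf_eq0.
  - by move=> g /ev_equation; rewrite QE => ->.
  - by move=> g; rewrite QE => /eqP; apply: ev_eval.
split.
  suff sub : {subset T m <= T m.+1}.
    move=> g gm.
    have h : ev (T m) g = 0 by apply/eqP; rewrite -QE.
    rewrite QE.
    rewrite (ev_sub sub h).
    exact: eqxx.
  move=> l.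
  rewrite !mem_cat; case: (l \in E0) => //= lT.
  by apply: mem_subseq lT; rewrite -[X in subseq X _](take_takel L (leqnSn m)) take_subseq.
have l0 : 'I_N by case: (L) lt => [|l].
pose l := nth l0 L m.
have lL : l \in L by apply: mem_nth.
have lT : l \in T m.+1.
  by rewrite mem_cat (take_nth l0) // mem_rcons mem_head orbT.
have lnT : l \notin T m.
  have := uniq_coordinates s_inj; rewrite cat_uniq => /and3P[_ /hasPn h uL].
  rewrite mem_cat negb_or h //=.
  have : uniq (take m L ++ drop m L) by rewrite cat_take_drop.
  rewrite cat_uniq => /and3P[_ /hasPn h' _].
  by apply: h'; rewrite (drop_nth l0) // mem_head.
(* the test polynomial of the parameter frozen at step [m] *)
have [lt1|ge1] := ltnP m (size L1); last first.
  have : l \in L2 by rewrite /l nth_cat ltnNge ge1 mem_nth // ltn_subLR // -size_cat.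
  case/allpairsP => -[i e] /= [i_s _ E].
  exists ('X_(mxvec_index i e) - (a (mxvec_index i e))%:MP); rewrite QE ev_coord_test //.
    by rewrite -E.
  by rewrite -E.
have : l \in L1 by rewrite /l nth_cat lt1 mem_nth.
case/allpairsP => -[j e] /= [+ _ E]; rewrite mem_off_codom => js.
have sub m' : (m' <= size L1)%N -> forall d, mxvec_index (anchor j) d \notin T m'.
  move=> le d; apply: contra (mem_outer_coordinates d (anchor_s js)).
  rewrite !mem_cat => /orP[-> //|]; rewrite takel_cat // => /mem_take ->.
  by rewrite orbT.
have jT m' : mxvec_index j ord_max \in T m'.
  by rewrite mem_cat; apply/orP; left; apply/mapP; exists j; rewrite ?mem_off_codom.
by exists (pencil_test j e); rewrite QE ev_pencil_test -?E //; apply: sub => //; apply: ltnW.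
Qed.

Lemma size_projection_chain : injective s -> size (L1 ++ L2) = ((n - 9) * 2 + 27)%N.
Proof.
move=> s_inj; rewrite size_cat !size_allpairs size_codom !card_ord size_enum_ord.
by rewrite (size_off_codom s_inj).
Qed.

End Param.

(** * Determinants to first order *)
Section Determinants.
Variable k : fieldType.

Lemma coef1M (p q : {poly k}) : (p * q)`_1 = p`_1 * q`_0 + p`_0 * q`_1.
Proof. by rewrite coefM big_ord_recl big_ord1 /= addrC. Qed.

Lemma coef0M (p q : {poly k}) : (p * q)`_0 = p`_0 * q`_0.
Proof. by rewrite coefM big_ord1. Qed.

Lemma coef0_prod I (r : seq I) (F : I -> {poly k}) :
  (\prod_(i <- r) F i)`_0 = \prod_(i <- r) (F i)`_0.
Proof.
elim: r => [|i r IH]; first by rewrite !big_nil coef1.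
by rewrite !big_cons coef0M IH.
Qed.

Lemma coef1_prod (I : eqType) (r : seq I) (F : I -> {poly k}) : uniq r ->
  (\prod_(i <- r) F i)`_1 =
  \sum_(i <- r) \prod_(j <- r) (if j == i then (F j)`_1 else (F j)`_0).
Proof.
elim: r => [_|i r IH /= /andP[ir ur]]; first by rewrite !big_nil coef1.
rewrite !big_cons coef1M IH // eqxx coef0_prod mulr_sumr; congr (_ * _ + _).
  rewrite [LHS]big_seq [RHS]big_seq; apply: eq_bigr => j jr.
  by case: eqP jr ir => // -> ->.
rewrite [LHS]big_seq [RHS]big_seq; apply: eq_bigr => j jr; rewrite big_cons.
by case: eqP jr ir => // -> ->.
Qed.

(** The product rule, with the derivatives gathered row by row. *)
Lemma coef1_det m (M : 'M[{poly k}]_m) :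
  (\det M)`_1 = \sum_i \sum_j (M i j)`_1 * cofactor (map_mx (coefp 0) M) i j.
Proof.
transitivity (\sum_i \det (\matrix_(i', j) if i' == i then (M i' j)`_1 else (M i' j)`_0)).
  rewrite /determinant exchange_big coef_sum; apply: eq_bigr => s _ /=.
  have sgn (b : bool) (p : {poly k}) : ((-1) ^+ b * p)`_1 = (-1) ^+ b * p`_1.
    by rewrite !mulr_sign; case: b; rewrite ?coefN.
  rewrite -mulr_sumr sgn coef1_prod ?index_enum_uniq //; congr (_ * _).
  by apply: eq_bigr => i _; apply: eq_bigr => i' _; rewrite mxE.
apply: eq_bigr => i _; rewrite (expand_det_row _ i); apply: eq_bigr => j _.
rewrite !mxE eqxx; congr (_ * (_ * \det _)); apply/matrixP => x y.
by rewrite !mxE eq_sym (negPf (neq_lift _ _)).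
Qed.

Lemma cofactor_eq0 m (M : 'M[k]_m.+1) i j : (\rank M < m)%N -> cofactor M i j = 0.
Proof.
move=> rM; rewrite /cofactor; apply/eqP; rewrite mulf_eq0; apply/orP; right.
apply: contraTT rM => nz; rewrite -leqNgt.
have U : row' i (col' j M) \in unitmx by rewrite unitmxE unitfE.
apply: (@leq_trans (\rank (row' i (col' j M)))); first by rewrite mxrank_unit.
have rowle p q (A : 'M[k]_(p, q)) (l : 'I_p) : (\rank (row' l A) <= \rank A)%N.
  by rewrite mxrankS // row'Esub rowsub_sub.
apply: leq_trans (rowle _ _ _ _) _.
by rewrite -mxrank_tr tr_col' -[X in (_ <= X)%N]mxrank_tr rowle.
Qed.

(** For a column [u] killed by [w], the entries of [\adj M *m u] are determinants
of matrices whose columns are all killed by [w].  So the adjugate factors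
through [w]. *)
Lemma adjugate_rank1 m (M : 'M[k]_m) (w : 'rV_m) : w != 0 -> w *m M = 0 ->
  exists2 theta : 'cV_m, \adj M = theta *m w & M *m theta = 0.
Proof.
move=> w0 wM.
have kill (u : 'cV_m) : w *m u = 0 -> \adj M *m u = 0.
  move=> wu; apply/colP => b; rewrite [RHS]mxE.
  pose B : 'M_m := \matrix_(r, b') if b' == b then u r 0 else M r b'.
  transitivity (\det B).
    rewrite (expand_det_col _ b) mxE; apply: eq_bigr => r _.
    rewrite !mxE eqxx mulrC; congr (_ * (_ * \det _)); apply/matrixP => x y.
    by rewrite !mxE eq_sym (negPf (neq_lift _ _)).
  apply/eqP/det0P; exists w => //; apply/rowP => b'; rewrite [RHS]mxE.
  have [->|ne] := eqVneq b' b.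
    move/colP/(_ 0): wu; rewrite [RHS]mxE => wu; rewrite -[RHS]wu !mxE.
    by apply: eq_bigr => r _; rewrite mxE eqxx.
  move/rowP/(_ b'): wM; rewrite [RHS]mxE => wM; rewrite -[RHS]wM !mxE.
  by apply: eq_bigr => r _; rewrite mxE (negPf ne).
have [r wr] : exists r, w 0 r != 0 by apply/rV0Pn.
pose h : 'cV[k]_m := (w 0 r)^-1 *: delta_mx r 0.
have wh : w *m h = 1%:M.
  apply/matrixP => x y; rewrite (ord1 x) (ord1 y) -scalemxAr -colE !mxE.
  by rewrite mulVf.
exists (\adj M *m h).
  apply/eqP; rewrite -subr_eq0 -mulmxA -{1}(mulmx1 (\adj M)) -mulmxBr; apply/eqP.
  apply/matrixP => x y; rewrite [RHS]mxE.
  have /colP/(_ x) : \adj M *m col y (1%:M - h *m w) = 0.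
    apply: kill; rewrite !colE mulmxA mulmxBr mulmxA wh mulmx1 mul1mx subrr.
    by rewrite mul0mx.
  by rewrite colE mulmxA -colE mxE [RHS]mxE.
rewrite mulmxA mul_mx_adj (_ : \det M = 0) ?raddf0 ?mul0mx //.
by apply/eqP/det0P; exists w.
Qed.
End Determinants.

(** * The tangent space *)
Section Subspaces.
Variables (k : fieldType) (N : nat).

Lemma vspace_of_mx m (M : 'M[k]_(m, N)) : exists2 V : {vspace 'rV[k]_N},
  \dim V = \rank M & forall v, v \in V <-> (v <= M)%MS.
Proof.
pose f : 'Hom('rV[k]_(\rank M), 'rV[k]_N) := linfun (mulmxr (row_base M)).
exists (limg f).
  rewrite limg_dim_eq ?dimvf /dim /= ?mul1n //.
  apply/eqP; rewrite -subv0; apply/subvP => u.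
  rewrite memv_cap memv_ker lfunE /= memv0 => /andP[_ /eqP u0].
  apply/eqP; apply: (row_free_inj (row_base_free M)); by rewrite u0 mul0mx.
move=> v; have <- : (v <= row_base M)%MS = (v <= M)%MS by rewrite eq_row_base.
split=> [/memv_imgP[u _ ->]|/submxP[u ->]]; first by rewrite lfunE /= submxMl.
by apply/memv_imgP; exists u; rewrite ?memvf ?lfunE.
Qed.

Lemma dim_vspace_mx m (M : 'M[k]_(m, N)) (V : {vspace 'rV[k]_N}) :
  (forall v, v \in V <-> (v <= M)%MS) -> \dim V = \rank M.
Proof.
move=> VM; have [V' <- V'M] := vspace_of_mx M; congr (\dim _); apply/vspaceP => v.
by apply/idP/idP => [/VM/V'M|/V'M/VM].
Qed.

End Subspaces.

Section FirstOrder.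
Variables (k : fieldType) (N : nat) (a : 'I_N -> k) (v : 'rV[k]_N).
Local Notation A := {mpoly k[N]}.

Definition restrict_line : {rmorphism A -> {poly k}} :=
  mmap (@polyC k) (fun l => (a l)%:P + 'X * (v 0 l)%:P).

Lemma restrict_lineC b : restrict_line b%:MP = b%:P.
Proof. by rewrite /restrict_line /= mmapC. Qed.

Lemma restrict_lineX l : restrict_line 'X_l = (a l)%:P + 'X * (v 0 l)%:P.
Proof. by rewrite /restrict_line /= mmapX mmap1U. Qed.

Lemma restrict_line_coef0 g : (restrict_line g)`_0 = g.@[a].
Proof.
rewrite -[g.@[a]]/(meval a g) -horner_coef0.
apply: (mpoly_rmorph_ext (f := horner_eval 0 \o restrict_line) (g := meval a)) => [b|l] /=.
  by rewrite restrict_lineC /horner_eval hornerC mevalC.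
by rewrite restrict_lineX /horner_eval !hornerE mevalXU.
Qed.

(** Both sides are derivations with the same values at the variables. *)
Lemma restrict_line_coef1 g :
  (restrict_line g)`_1 = \sum_(l < N) g^`M(l).@[a] * v 0 l.
Proof.
pose D g := \sum_(l < N) g^`M(l).@[a] * v 0 l; rewrite -/(D g).
pose Q (g : A) := (restrict_line g)`_1 = D g.
have QD x y : Q x -> Q y -> Q (x + y).
  rewrite /Q rmorphD coefD => -> ->; rewrite /D -big_split; apply: eq_bigr => l _ /=.
  by rewrite mderivD mevalD mulrDl.
have QM x y : Q x -> Q y -> Q (x * y).
  rewrite /Q rmorphM coef1M !restrict_line_coef0 => -> ->.
  rewrite /D mulr_suml mulr_sumr -big_split; apply: eq_bigr => l _ /=.
  by rewrite mderivM mevalD !mevalM mulrDl mulrAC mulrA.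
have QC b : Q b%:MP.
  rewrite /Q restrict_lineC coefC /= /D big1 // => l _.
  by rewrite mderivC meval0 mul0r.
have QX l : Q 'X_l.
  rewrite /Q restrict_lineX coefD coefC add0r coefXM coefC /= /D (bigD1 l) //= big1 ?addr0.
    rewrite mderivX mnm1E eqxx scale1r (_ : (_ - _)%MM = 0%MM).
      by rewrite mpolyX0 meval1 mul1r.
    by apply/mnmP => i; rewrite mnmBE subnn mnm0E.
  move=> l' ne; rewrite mderivX mnm1E eq_sym (negPf ne) scale0r meval0 mul0r //.
change (Q g); rewrite (mpolyE g); apply: (big_ind Q) => //.
  by rewrite -mpolyC0.
move=> m _; rewrite -mul_mpolyC; apply: (QM) => //; rewrite mpolyXE_id.
apply: (big_ind Q) => //; first by rewrite -mpolyC1.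
move=> l _; elim: (m l) => [|e IH]; first by rewrite expr0 -mpolyC1.
by rewrite exprS; apply: (QM).
Qed.
End FirstOrder.

Section Tangent.
Variables (k : fieldType) (n : nat) (c : 'I_n -> 'I_4) (a : 'I_(n * 3) -> k).
Local Notation N := (n * 3)%N.
Local Notation P := (chart_point c a).
Local Notation V := (veronese_mx P).

(** The coordinate which is 1 in the chart stays constant. *)
Definition direction (v : 'rV[k]_N) (j : 'I_n) : 'rV[k]_4 :=
  \row_d if unlift (c j) d is Some e then v 0 (mxvec_index j e) else 0.

Lemma restrict_line_point v j :
  map_mx (restrict_line a v) (universal_point k c j) =
  1 *: map_mx polyC (P j) + 'X *: map_mx polyC (direction v j).
Proof.
rewrite map_universal_point; apply/rowP => d; rewrite !mxE.
case: unliftP => [e _|_]; rewrite mul1r.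
  by rewrite restrict_lineX.
by rewrite polyC1 polyC0 mulr0 addr0.
Qed.

(** The derivative at [z] along [d] of the column of quadratic monomials. *)
Definition velocity (z d : 'rV[k]_4) : 'cV[k]_10 := \col_r polar (delta_mx 0 r) z d.

Lemma polar_velocity w z d : (w *m velocity z d) 0 0 = polar w z d.
Proof.
rewrite mxE {2}[w]row_sum_delta; set s := index_enum _.
elim: s => [|r s IH]; first by rewrite !big_nil /polar !qform0l !subr0.
rewrite !big_cons IH mxE /polar !qformDl !qformZl; ring.
Qed.

Lemma qform_delta (R : comNzRingType) (x : 'rV[R]_4) r :
  qform (delta_mx 0 r) x = qv x r 0.
Proof. by rewrite /qform -rowE mxE. Qed.

Lemma minor_coef1 v s :
  (restrict_line a v (maximal_minor (universal_point k c) s))`_1 =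
  \sum_r \sum_b velocity (P (s b)) (direction v (s b)) r 0 * cofactor (colsub s V) r b.
Proof.
rewrite map_maximal_minor /maximal_minor coef1_det.
have E r j : veronese_mx (fun i => map_mx (restrict_line a v) (universal_point k c i)) r j =
  qform (map_mx polyC (delta_mx 0 r)) (1 *: map_mx polyC (P j) + 'X *: map_mx polyC (direction v j)).
  rewrite -restrict_line_point map_delta_mx qform_delta mxE.
  by rewrite mxE.
have E' r j : veronese_mx (fun i => map_mx (restrict_line a v) (universal_point k c i)) r j =
  (qv (P j) r 0)%:P + 'X * (polar (delta_mx 0 r) (P j) (direction v j))%:P +
  'X^2 * (qv (direction v j) r 0)%:P.
  rewrite E qform_comb -!map_qform -map_polar !qform_delta; ring.
apply: eq_bigr => r _; apply: eq_bigr => b _; congr (_ * _).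
  by rewrite mxE E' !coefD coefC coefXM coefC coefXnM /= add0r addr0 [RHS]mxE.
congr (cofactor _ _ _); apply/matrixP => x y.
rewrite mxE [X in coefp 0 X]mxE E' /= !coefD coefC coefXM coefXnM /= !addr0.
by rewrite !mxE.
Qed.

Variable w : 'rV[k]_10.

Definition polar_row v : 'rV[k]_n := \row_j polar w (P j) (direction v j).

(** The matrix of the map sending a displacement to the derivatives of [w] at the
points. *)
Definition gradient : 'M[k]_(N, n) := \matrix_(l, j) polar_row (delta_mx 0 l) 0 j.

Lemma polar_rowE v : polar_row v = v *m gradient.
Proof.
apply/rowP => j; rewrite !mxE.
have -> : direction v j = \sum_l v 0 l *: direction (delta_mx 0 l) j.
  apply/rowP => d; rewrite summxE mxE.
  case E: (unlift (c j) d) => [e|]; last first.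
    by rewrite big1 // => l _; rewrite !mxE E mulr0.
  rewrite (bigD1 (mxvec_index j e)) //= big1 ?addr0 => [|l ne].
    by rewrite !mxE E mxE !eqxx mulr1.
  by rewrite !mxE E mxE eq_sym (negPf ne) mulr0.
rewrite polar_sumr; apply: eq_bigr => l _.
by rewrite polarZr !mxE.
Qed.

Hypotheses (w0 : w != 0) (wP : forall i, qform w (P i) = 0).

(** By [adjugate_rank1] the derivative of a minor is a linear combination of the
entries of [polar_row v], whose coefficients [th] form a linear relation between
the ten columns.  Vectors of the row space satisfy every such relation.
Conversely, subtract a vector of the row space to make the entries at the nine
independent columns vanish; the minor with the additional column [j] then makes
the entry [j] vanish, as its relation must involve that column. *)
Lemma tangent_vector_rank9 s9 v : injective s9 -> interpolant P s9 != 0 ->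
  \rank (colsub s9 V) = 9%N ->
  tangent_vector (X32_equations (k := k) c) a v <-> (polar_row v <= V)%MS.
Proof.
move=> s9_inj iP rk.
have wV : w *m V = 0 by apply/left_kernelP.
pose F (x : 'rV[k]_n) (th : 'cV_10) (s : 'I_10 -> 'I_n) := \sum_b th b 0 * x 0 (s b).
have theta s : exists2 th : 'cV_10, \adj (colsub s V) = th *m w & colsub s V *m th = 0.
  apply: adjugate_rank1 => //; rewrite mulmx_colsub wV.
  by apply/rowP => b; rewrite !mxE.
have FV (w' : 'rV_10) s th : colsub s V *m th = 0 -> F (w' *m V) th s = 0.
  move=> Vth; have := congr1 (fun M : 'cV_10 => (w' *m M) 0 0) Vth.
  rewrite /= mulmx0 mulmxA mulmx_colsub [RHS]mxE mxE => E; rewrite -[RHS]E.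
  by apply: eq_bigr => b _; rewrite mulrC [in RHS]mxE.
have tangF : tangent_vector (X32_equations (k := k) c) a v <->
    forall s th, injective s -> \adj (colsub s V) = th *m w -> F (polar_row v) th s = 0.
  have key s th : \adj (colsub s V) = th *m w ->
      \sum_(l < N) (maximal_minor (universal_point k c) s)^`M(l).@[a] * v 0 l =
      F (polar_row v) th s.
    move=> adjE; rewrite -restrict_line_coef1 minor_coef1 exchange_big.
    apply: eq_bigr => b _; rewrite [polar_row _ _ _]mxE -polar_velocity mxE mulr_sumr.
    apply: eq_bigr => r _; move/matrixP/(_ b r): adjE.
    by rewrite [LHS]mxE [RHS]mxE big_ord1 => ->; rewrite mulrC -mulrA.
  split=> [tg s th s_inj adjE|h g [s s_inj ->]].
    by rewrite -(key _ _ adjE); apply: tg; exists s.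
  by have [th adjE _] := theta s; rewrite (key _ _ adjE); apply: h adjE.
rewrite tangF; split=> [h|/submxP[w' ->] s th _ adjE]; last first.
  have [th' adjE' Vth'] := theta s; suff -> : th = th' by apply: FV.
  have /rV0Pn[r wr] := w0; apply/colP => b.
  have /matrixP/(_ b r) : th *m w = th' *m w by rewrite -adjE.
  by rewrite !mxE !big_ord1 => /(mulIf wr).
have full : row_full (colsub s9 V) by rewrite /row_full rk.
have /submxP[w' Ew'] : (colsub s9 (polar_row v) <= colsub s9 V)%MS by apply: submx_full.
have e9 b : polar_row v 0 (s9 b) = (w' *m V) 0 (s9 b).
  by move/rowP/(_ b): Ew'; rewrite mulmx_colsub [LHS]mxE [RHS]mxE.
suff -> : polar_row v = w' *m V by apply: submxMl.
apply/rowP => j; have [/codomP[b ->]|js] := boolP (j \in codom s9); first exact: e9.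
have sj b : s9 b != j by apply: contraNneq js => <-; apply: codom_f.
pose s := extend_sel s9 j.
have [th adjE Vth] := theta s.
have := h s th (extend_sel_inj s9_inj sj) adjE.
rewrite /F (bigD1 (ord_max : 'I_10)) //= => e2.
have := FV w' s th Vth.
rewrite /F (bigD1 (ord_max : 'I_10)) //= => e1.
have sm : s ord_max = j by rewrite /s /extend_sel unlift_none.
(* the row [ord_max] of the adjugate is the interpolating quadric *)
have thm : th ord_max 0 != 0.
  apply: contraNneq iP => th0; apply/eqP/rowP => r; rewrite [RHS]mxE.
  have /matrixP/(_ ord_max r) := adjE; rewrite [RHS]mxE big_ord1 th0 mul0r => E.
  rewrite -[RHS]E 2!mxE /cofactor; congr (_ * \det _); apply/matrixP => x y.
  by rewrite !mxE /s /extend_sel liftK.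
apply: (mulfI thm); rewrite -sm; apply: (addIr (\sum_(i < 10 | i != ord_max) th i 0 * (w' *m V) 0 (s i))).
rewrite e1 -[RHS]e2; congr (_ + _); apply: eq_bigr => b; rewrite eq_sym => /unlift_some[b' -> _].
by rewrite /s /extend_sel liftK e9.
Qed.

Lemma tangent_dim_rank9 s9 d : injective s9 -> interpolant P s9 != 0 ->
  \rank (colsub s9 V) = 9%N ->
  tangent_dim (X32_equations (k := k) c) a d <->
  d = (N - \rank (gradient *m cokermx V))%N.
Proof.
move=> s9_inj iP rk; set M := gradient *m cokermx V.
have tgM v : tangent_vector (X32_equations (k := k) c) a v <-> (v <= kermx M)%MS.
  rewrite (tangent_vector_rank9 v s9_inj iP rk) submxE polar_rowE -mulmxA.
  by split=> [/eqP h|/sub_kermxP ->] //; apply/sub_kermxP.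
split=> [[W <- WT]|->].
  by rewrite -mxrank_ker; apply: dim_vspace_mx => v; rewrite WT tgM.
have [W dW WM] := vspace_of_mx (kermx M).
by exists W => [|v]; rewrite -?mxrank_ker // WM tgM.
Qed.

Definition singular_for (x : 'rV[k]_4) := [forall e, polar w x (delta_mx 0 e) == 0].

Lemma singular_forP x : reflect (forall y, polar w x y = 0) (singular_for x).
Proof.
apply: (iffP forallP) => [h y|h e]; last by rewrite h.
rewrite [y]row_sum_delta polar_sumr big1 // => e _.
by rewrite polarZr (eqP (h e)) mulr0.
Qed.

Lemma gradient_index j e j' : gradient (mxvec_index j e) j' =
  if j' == j then polar w (P j) (delta_mx 0 (lift (c j) e)) else 0.
Proof.
rewrite !mxE; case: eqP => [->|ne].
  congr (polar _ _ _); apply/rowP => d; rewrite !mxE.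
  case: unliftP => [e' ->|->]; last by rewrite (negPf (neq_lift _ _)) andbF.
  by rewrite mxE mxvec_index_eq !eqxx (inj_eq (@lift_inj _ _)).
rewrite (_ : direction _ _ = 0) ?polar0r //; apply/rowP => d; rewrite !mxE.
case: unliftP => [e' _|//]; rewrite mxE mxvec_index_eq.
by rewrite (introF eqP ne) andbF.
Qed.

(** The affine partial derivatives of [w] at a point of the quadric determine the
last one, by Euler's relation. *)
Lemma gradient_ker (u : 'cV[k]_n) :
  gradient *m u = 0 <-> forall j, ~~ singular_for (P j) -> u j 0 = 0.
Proof.
have E j e : (gradient *m u) (mxvec_index j e) 0 =
    polar w (P j) (delta_mx 0 (lift (c j) e)) * u j 0.
  rewrite mxE (bigD1 j) //= gradient_index eqxx big1 ?addr0 // => j' ne.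
  by rewrite gradient_index (negPf ne) mul0r.
split=> [h j|h].
  apply: contraNeq => uj; apply/singular_forP => y.
  have van e : polar w (P j) (delta_mx 0 (lift (c j) e)) = 0.
    by apply: (mulIf uj); rewrite -E h mxE mul0r.
  have vanc : polar w (P j) (delta_mx 0 (c j)) = 0.
    have := polarxx w (P j); rewrite wP mul0rn {2}[P j]row_sum_delta polar_sumr.
    rewrite (bigD1 (c j)) //= chart_point_c scale1r big1 ?addr0 // => d.
    by rewrite eq_sym => /unlift_some[e -> _]; rewrite polarZr van mulr0.
  rewrite [y]row_sum_delta polar_sumr big1 // => d _; rewrite polarZr.
  by case: (unliftP (c j) d) => [e ->|->]; rewrite ?van ?vanc mulr0.
apply/colP => l; rewrite [RHS]mxE; case/mxvec_indexP: l => j e; rewrite E.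
have [/singular_forP ->|/h ->] := boolP (singular_for (P j)); first by rewrite mul0r.
by rewrite mulr0.
Qed.

(** The entries which are singular on [w] impose independent conditions on
quadrics: there is no linear relation between their columns. *)
Definition singular_independent :=
  forall u : 'cV[k]_n, (forall j, ~~ singular_for (P j) -> u j 0 = 0) ->
    V *m u = 0 -> u = 0.

(** The columns of [cokermx V] are the linear relations between the columns of
[V], a space of dimension [n - 9].  The rank of its product with [gradient],
which is the codimension of the tangent space, is maximal when no relation is
supported on the singular entries. *)
Lemma singular_independentP : \rank V = 9%N ->
  singular_independent <-> \rank (gradient *m cokermx V) = (n - 9)%N.
Proof.
move=> rV; set C := cokermx V; set Cap := (C^T :&: kermx gradient^T)%MS.
have rC : \rank C^T = (n - 9)%N by rewrite mxrank_tr mxrank_coker rV.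
have := mxrank_mul_ker C^T gradient^T; rewrite -trmx_mul rC (mxrank_tr (gradient *m C)) -/Cap => rk.
have CV : (C^T == kermx V^T)%MS.
  have sub : (C^T <= kermx V^T)%MS.
    by apply/sub_kermxP; rewrite -trmx_mul mulmx_coker trmx0.
  rewrite sub /=; have [_ <-] := mxrank_leqif_sup sub.
  by rewrite rC mxrank_ker mxrank_tr rV.
have -> : \rank (gradient *m C) = (n - 9)%N <-> Cap = 0.
  split=> [E|c0]; last by move: rk; rewrite c0 mxrank0 addn0.
  by apply/eqP; rewrite -mxrank_eq0; move: rk; rewrite E => /eqP; rewrite -[X in _ == X]addn0 eqn_add2l.
split=> [ind|c0 u /gradient_ker gu Vu].
  apply/eqP/rowV0P => x; rewrite sub_capmx => /andP[xC /sub_kermxP xg].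
  apply: trmx_inj; rewrite trmx0; apply: ind.
    by apply/gradient_ker; apply: trmx_inj; rewrite trmx_mul trmxK trmx0.
  move: xC; rewrite (eqmxP CV) => /sub_kermxP h.
  by apply: trmx_inj; rewrite trmx_mul trmxK trmx0.
apply: trmx_inj; rewrite trmx0; apply/eqP; rewrite -submx0 -c0 sub_capmx (eqmxP CV).
by apply/andP; split; apply/sub_kermxP; rewrite -trmx_mul ?Vu ?gu trmx0.
Qed.

End Tangent.

Section LowRank.
Variables (k : fieldType) (n : nat) (c : 'I_n -> 'I_4) (a : 'I_(n * 3) -> k).

Lemma tangent_vector_low_rank v : (\rank (veronese_mx (chart_point c a)) < 9)%N ->
  tangent_vector (X32_equations (k := k) c) a v.
Proof.
move=> lt g [s _ ->]; rewrite -restrict_line_coef1 minor_coef1.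
apply: big1 => r _; apply: big1 => b _; rewrite cofactor_eq0 ?mulr0 //.
apply: leq_ltn_trans lt; rewrite -mxrank_tr trmx_mxsub -[X in (_ <= X)%N]mxrank_tr.
by rewrite mxrankS // rowsub_sub.
Qed.

Lemma tangent_dim_low_rank d : (\rank (veronese_mx (chart_point c a)) < 9)%N ->
  tangent_dim (X32_equations (k := k) c) a d -> d = (n * 3)%N.
Proof.
move=> lt [W <- WT]; rewrite -[RHS](mxrank1 k).
apply: dim_vspace_mx => v; rewrite submx1; split=> // _.
exact/WT/tangent_vector_low_rank.
Qed.
End LowRank.

(** * Products of linear forms *)
Section LinearFormsRing.
Variable R : comNzRingType.
Implicit Types l m x : 'rV[R]_4.

Definition lin l x : R := \sum_e l 0 e * x 0 e.

Definition prod_form l m : 'rV[R]_10 := \row_r tnth [tuple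
  l 0 0 * m 0 0; l 0 0 * m 0 1 + l 0 1 * m 0 0; l 0 0 * m 0 2%:R + l 0 2%:R * m 0 0;
  l 0 0 * m 0 3%:R + l 0 3%:R * m 0 0; l 0 1 * m 0 1; l 0 1 * m 0 2%:R + l 0 2%:R * m 0 1;
  l 0 1 * m 0 3%:R + l 0 3%:R * m 0 1; l 0 2%:R * m 0 2%:R;
  l 0 2%:R * m 0 3%:R + l 0 3%:R * m 0 2%:R; l 0 3%:R * m 0 3%:R] r.

Lemma linE l x : lin l x = l 0 0 * x 0 0 + l 0 1 * x 0 1 + l 0 2%:R * x 0 2%:R
  + l 0 3%:R * x 0 3%:R.
Proof.
rewrite /lin !big_ord_recl big_ord0 addr0 !addrA.
by do !congr (_ + _); congr (l _ _ * x _ _); apply: val_inj.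
Qed.

Lemma linDr l x y : lin l (x + y) = lin l x + lin l y.
Proof. rewrite !linE !mxE; ring. Qed.

Lemma linDl l m x : lin (l + m) x = lin l x + lin m x.
Proof. rewrite !linE !mxE; ring. Qed.

Lemma linZl a l x : lin (a *: l) x = a * lin l x.
Proof. rewrite !linE !mxE; ring. Qed.

Lemma lin_delta l e : lin l (delta_mx 0 e) = l 0 e.
Proof.
rewrite /lin (bigD1 e) //= mxE !eqxx mulr1 big1 ?addr0 // => e' ne.
by rewrite mxE (negPf ne) mulr0.
Qed.

Lemma qform_prod_form l m x : qform (prod_form l m) x = lin l x * lin m x.
Proof. rewrite qformE !linE !mxE /tnth /=; ring. Qed.

Lemma prod_formDZ l m m' b : prod_form l (m + b *: m') = prod_form l m + b *: prod_form l m'.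
Proof.
apply/rowP => r; rewrite !mxE; case: r => r lt.
by do 10?[case: r lt => [|r] lt; first by rewrite /tnth /=; ring].
Qed.
End LinearFormsRing.

Lemma map_prod_form (R S : comNzRingType) (f : {rmorphism R -> S}) (l m : 'rV[R]_4) :
  map_mx f (prod_form l m) = prod_form (map_mx f l) (map_mx f m).
Proof.
apply/rowP => r; rewrite !mxE; case: r => r lt.
by do 10?[case: r lt => [|r] lt; first by rewrite /tnth /= ?rmorphD !rmorphM].
Qed.

Section LinearForms.
Variable k : fieldType.
Implicit Types l m x : 'rV[k]_4.

Lemma lin_neq0 l : l != 0 -> exists x, lin l x != 0.
Proof. by case/rV0Pn => e le; exists (delta_mx 0 e); rewrite lin_delta. Qed.

(** Two vectors are enough over any field, even a finite one. *)
Lemma lin_mul_neq0 l m : l != 0 -> m != 0 -> exists x, lin l x * lin m x != 0.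
Proof.
move=> /lin_neq0[x lx] /lin_neq0[y my].
have [mx|mx] := eqVneq (lin m x) 0; last by exists x; rewrite mulf_neq0.
have [ly|ly] := eqVneq (lin l y) 0; last by exists y; rewrite mulf_neq0.
by exists (x + y); rewrite !linDr mx ly addr0 add0r mulf_neq0.
Qed.

Lemma prod_form_eq0 l m : prod_form l m = 0 -> (l == 0) || (m == 0).
Proof.
move=> h; apply: contraT; rewrite negb_or => /andP[l0 m0].
have [x] := lin_mul_neq0 l0 m0.
by rewrite -qform_prod_form h qform0l eqxx.
Qed.

(** This refutes the uniqueness of a quadric when all the points lie on a plane
[l = 0] defined over the ground field. *)
Lemma prod_form_not_prop l (w : 'rV_10) : l != 0 ->
  ~ (forall m, (prod_form l m <= w)%MS).
Proof.
move=> l0 h.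
have /sub_rVP[b0 h0] := h (delta_mx 0 0); have /sub_rVP[b1 h1] := h (delta_mx 0 1).
have d10 : (delta_mx 0 0 : 'rV[k]_4) != 0.
  by apply/rV0Pn; exists 0; rewrite mxE eqxx oner_neq0.
have b1n : b0 != 0.
  apply: contraNneq l0 => b0z; move: h0; rewrite b0z scale0r => /prod_form_eq0.
  by rewrite (negPf d10) orbF.
have : prod_form l (delta_mx 0 1 + (- (b1 / b0)) *: delta_mx 0 0) = 0.
  by rewrite prod_formDZ h0 h1 scalerA mulNr divfK // scaleNr subrr.
case/prod_form_eq0/orP => /eqP; first by move/eqP; rewrite (negPf l0).
by move/rowP/(_ 1)/eqP; rewrite !mxE /= mulr0 addr0 oner_eq0.
Qed.

End LinearForms.

(** * Independent columns *)
Section Columns.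
Variables (k : fieldType) (m n : nat) (V : 'M[k]_(m, n)).

Definition independent_cols (J : {set 'I_n}) :=
  forall u : 'cV[k]_n, (forall j, j \notin J -> u j 0 = 0) -> V *m u = 0 -> u = 0.

(** A maximal independent set of columns containing [J0] is a basis of the column
space. *)
Lemma extend_independent_cols (J0 : {set 'I_n}) : independent_cols J0 ->
  exists r (s : 'I_r -> 'I_n), [/\ r = \rank V, injective s, \rank (colsub s V) = r
    & forall j, j \in J0 -> j \in codom s].
Proof.
move=> ind0; pose F (J : {set 'I_n}) := `[< independent_cols J >].
have [J /maxsetP[/asboolP indJ maxJ] J0J] : {J | maxset F J & J0 \subset J}.
  by apply: maxset_exists; apply/asboolP.
pose s (b : 'I_#|J|) : 'I_n := enum_val b; pose W := colsub s V.
have s_inj : injective s by apply: enum_val_inj.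
have colsE (u : 'cV[k]_n) : (forall j, j \notin J -> u j 0 = 0) ->
    V *m u = W *m (\col_b u (s b) 0).
  move=> uJ; apply/colP => r; rewrite !mxE (bigID (mem J)) /= [X in _ + X]big1 => [|j jJ].
    by rewrite addr0 big_enum_val; apply: eq_bigr => b _; rewrite !mxE.
  by rewrite uJ // mulr0.
have Wfree : row_free W^T.
  apply: inj_row_free => x xW.
  pose u : 'cV[k]_n := \col_j (if j \in J then \sum_(b | s b == j) x 0 b else 0).
  have us b : u (s b) 0 = x 0 b.
    rewrite mxE enum_valP (big_pred1 b) // => b'; exact: (inj_eq s_inj).
  have u0 : u = 0.
    apply: indJ => [j jJ|]; first by rewrite mxE (negPf jJ).
    rewrite colsE => [|j jJ]; last by rewrite mxE (negPf jJ).
    have -> : \col_b u (s b) 0 = x^T by apply/colP => b; rewrite mxE us mxE.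
    by apply: trmx_inj; rewrite trmx_mul trmxK trmx0.
  by apply/rowP => b; rewrite -us u0 !mxE.
have VW : (V^T <= W^T)%MS.
  apply/row_subP => i; have [iJ|iJ] := boolP (i \in J).
    have -> : row i V^T = row (enum_rank_in iJ i) W^T.
      by apply/rowP => r; rewrite !mxE /s enum_rankK_in.
    exact: row_sub.
  have : ~ independent_cols (i |: J).
    move=> indi; have : i |: J = J by apply: maxJ; [apply/asboolP | apply: subsetU1].
    by move=> E; move: iJ; rewrite -E setU11.
  move=> nind; have [u [uJ Vu un]] : exists u : 'cV[k]_n,
      [/\ forall j, j \notin i |: J -> u j 0 = 0, V *m u = 0 & u <> 0].
    by apply: contrapT => nex; apply: nind => u uJ Vu; apply: contrapT => un;
       apply: nex; exists u.
  have ui : u i 0 != 0.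
    apply/eqP => ui0; apply: un; apply: indJ => // j jJ.
    have [->//|ne] := eqVneq j i; by apply: uJ; rewrite in_setU1 negb_or ne.
  pose u' : 'cV[k]_n := u - u i 0 *: delta_mx i 0.
  have u'J j : j \notin J -> u' j 0 = 0.
    move=> jJ; rewrite !mxE eqxx andbT; have [->|ne] := eqVneq j i.
      by rewrite mulr1 subrr.
    by rewrite mulr0 subr0 uJ // in_setU1 negb_or ne.
  have : V *m u' = - u i 0 *: col i V.
    by rewrite mulmxBr Vu sub0r -scalemxAr -colE scaleNr.
  rewrite colsE // => E.
  have -> : row i V^T = (- u i 0)^-1 *: ((\col_b u' (s b) 0)^T *m W^T).
    by rewrite -trmx_mul E linearZ /= scalerA mulVf ?oppr_eq0 // scale1r tr_col.
  by rewrite scalemx_sub // submxMl.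
have cardJ : #|J| = \rank V.
  have <- : \rank W^T = \rank V.
    apply/eqP; rewrite -(mxrank_tr V) eqn_leq mxrankS ?trmx_mxsub ?rowsub_sub //=.
    by rewrite mxrankS // -trmx_mxsub.
  by rewrite (eqP Wfree).
exists #|J|, s; split=> //; first by rewrite -mxrank_tr (eqP Wfree).
move=> j /(subsetP J0J) jJ; apply/codomP; exists (enum_rank_in jJ j).
by rewrite /s enum_rankK_in.
Qed.
End Columns.

Lemma sub_rank1 (k : fieldType) m n (w : 'rV[k]_n) (A : 'M_(n, m)) : w != 0 ->
  w *m A = 0 -> \rank A = n.-1 -> (kermx A <= w)%MS.
Proof.
move=> w0 wA rA; have n0 : (0 < n)%N by case: n w w0 {A wA rA} => // w; rewrite thinmx0 eqxx.
have sub : (w <= kermx A)%MS by apply/sub_kermxP.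
have [_ <-] := mxrank_leqif_sup sub.
by rewrite mxrank_ker rA rank_rV w0 -{1}(prednK n0) subSnn.
Qed.

(** * Smoothness in terms of ranks *)
Section Core.
Variables (k : fieldType) (n : nat) (c : 'I_n -> 'I_4) (a : 'I_(n * 3) -> k).
Local Notation N := (n * 3)%N.
Local Notation P := (chart_point c a).
Local Notation V := (veronese_mx P).
Hypotheses (ch2 : 2%:R != 0 :> k) (hn : (10 <= n)%N).
Variable w : 'rV[k]_10.
Hypotheses (w0 : w != 0) (wP : forall i, qform w (P i) = 0).

Lemma interpolant_prop s9 : \rank (colsub s9 V) = 9%N ->
  exists2 b, b != 0 & interpolant P s9 = b *: w.
Proof.
move=> rk; have := interpolant_neq0 rk.
have wV : w *m colsub s9 V = 0.
  have /left_kernelP h := wP; rewrite mulmx_colsub h.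
  by apply/matrixP => x y; rewrite !mxE.
have /sub_rVP[b ->] : (interpolant P s9 <= w)%MS.
  apply: submx_trans (sub_rank1 w0 wV rk); apply/sub_kermxP; rewrite mulmx_colsub.
  apply/rowP => b; rewrite [RHS]mxE mxE -[RHS](interpolant_sel P s9 b) qform_sum mxE.
  by apply: eq_bigr => r _; rewrite [veronese_mx _ _ _]mxE.
by rewrite scaler_eq0 negb_or => /andP[b0 _]; exists b.
Qed.

(** In rank at most 8 the tangent space has dimension 3n and the local dimension is
smaller.  In rank 9 the local dimension is at most 2n + 9, the least possible
dimension of the tangent space. *)
Lemma smooth_rank9 : affine_smooth_at (X32_equations (k := k) c) a ->
  \rank V = 9%N /\ singular_independent c a w.
Proof.
move=> [d tg [ch _]].
have lt9 : (\rank V <= 9)%N.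
  have /left_kernelP wV := wP.
  have sub : (w <= kermx V)%MS by apply/sub_kermxP.
  have := mxrankS sub; rewrite rank_rV w0 mxrank_ker; lia.
have rV : \rank V = 9%N.
  apply/eqP; rewrite eqn_leq lt9 leqNgt; apply/negP => lt.
  have := local_chain_bound ch2 hn ch.
  by rewrite (tangent_dim_low_rank lt tg) ltnn.
split=> //.
have ind0 : independent_cols V set0.
  by move=> u u0 _; apply/colP => j; rewrite u0 ?inE // mxE.
have [r [s [rE s_inj rs _]]] := extend_independent_cols ind0.
move: s s_inj rs; rewrite rE rV => s s_inj rs.
have iP := interpolant_neq0 rs.
have := local_chain_bound_interpolant ch2 s_inj iP ch.
have /(tangent_dim_rank9 w0 wP _ s_inj iP rs) dE := tg.
move=> bound; apply: (proj2 (singular_independentP wP rV)).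
have le : (\rank (gradient c a w *m cokermx V) <= n - 9)%N.
  by apply: leq_trans (mxrankM_maxr _ _) _; rewrite mxrank_coker rV.
move: bound; rewrite dE; lia.
Qed.

(** The nine independent columns are chosen so as to contain the singular entries.
Then every remaining point [j] is smooth, and [anchor j] is a chosen point
outside its tangent plane: otherwise the products of the equation of this plane
by all linear forms would be quadrics through the nine points. *)
Lemma rank9_smooth : \rank V = 9%N -> singular_independent c a w ->
  affine_smooth_at (X32_equations (k := k) c) a.
Proof.
move=> rV ind; pose J0 := [set j | singular_for w (P j)].
have ind0 : independent_cols V J0.
  by move=> u uJ; apply: ind => j js; apply: uJ; rewrite inE.
have [r [s [rE s_inj rs sJ]]] := extend_independent_cols ind0.
move: s s_inj rs sJ; rewrite rE rV => s s_inj rs sJ.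
have [b b0 iE] := interpolant_prop rs.
have iP := interpolant_neq0 rs.
have anchor_ex j : j \notin codom s -> exists b', polar (interpolant P s) (P (s b')) (P j) != 0.
  move=> js; apply: contrapT => nex.
  have nsing : ~~ singular_for w (P j) by apply: contra js => js; apply: sJ; rewrite inE.
  pose l : 'rV[k]_4 := \row_e polar w (P j) (delta_mx 0 e).
  have linl x : lin l x = polar w (P j) x.
    rewrite [x in RHS]row_sum_delta polar_sumr /lin; apply: eq_bigr => e _.
    by rewrite polarZr mxE mulrC.
  have l0 : l != 0.
    apply: contraNneq nsing => l0; apply/singular_forP => x.
    by rewrite -linl l0 linE !mxE; ring.
  apply: (@prod_form_not_prop _ l w l0) => m.
  have wV : w *m colsub s V = 0.
    have /left_kernelP h := wP; rewrite mulmx_colsub h.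
    by apply/matrixP => x y; rewrite !mxE.
  apply: submx_trans (sub_rank1 w0 wV rs); apply/sub_kermxP; rewrite mulmx_colsub.
  apply/rowP => b'; rewrite [RHS]mxE mxE.
  transitivity (qform (prod_form l m) (P (s b'))).
    by rewrite qform_sum mxE; apply: eq_bigr => r' _; rewrite [veronese_mx _ _ _]mxE.
  rewrite qform_prod_form linl; suff -> : polar w (P j) (P (s b')) = 0 by rewrite mul0r.
  apply: contrapT => /eqP ne; apply: nex; exists b'; rewrite iE polarC.
  by rewrite /polar !qformZl -!mulrBr mulf_neq0.
pose anchor j : 'I_n := if [pick b' | polar (interpolant P s) (P (s b')) (P j) != 0] is Some b'
  then s b' else j.
have anchorP j : j \notin codom s ->
    anchor j \in codom s /\ polar (interpolant P s) (P (anchor j)) (P j) != 0.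
  move=> js; rewrite /anchor; case: pickP => [b' pb|none]; first by rewrite codom_f.
  by have [b' pb] := anchor_ex j js; have := none b'; rewrite pb.
have iPP i : qform (interpolant P s) (P i) = 0 by rewrite iE qformZl wP mulr0.
have chain := projection_chain iP iPP (fun j js => (anchorP j js).1)
  (fun j js => (anchorP j js).2) s_inj.
rewrite (size_projection_chain s_inj) in chain.
exists ((n - 9) * 2 + 27)%N.
  apply: (proj2 (tangent_dim_rank9 w0 wP _ s_inj iP rs)).
  by have /(singular_independentP wP rV) -> := ind; lia.
split=> // e /(local_chain_bound_interpolant ch2 s_inj iP); lia.
Qed.
End Core.

(** * Quadric polynomials and their singular points *)
Section QuadricPolynomials.
Variable k : fieldType.
Implicit Types (w : 'rV[k]_10) (x y : 'rV[k]_4).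

Definition variables (m : nat) : 'rV[{mpoly k[m]}]_m := \row_i 'X_i.

Definition quad_poly w : {mpoly k[4]} :=
  qform (map_mx (@mpolyC 4 k) w) (variables 4).

Lemma quad_poly_eval w x : (quad_poly w).@[x 0] = qform w x.
Proof.
rewrite /quad_poly -[LHS]/(meval (x 0) _) map_qform; congr (qform _ _).
  by apply/rowP => r; rewrite !mxE /= mevalC.
by apply/rowP => e; rewrite !mxE /= mevalXU.
Qed.

Lemma quad_polyZ b w : quad_poly (b *: w) = b *: quad_poly w.
Proof. by rewrite /quad_poly map_mxZ qformZl mul_mpolyC. Qed.

Lemma quad_polyD w w' : quad_poly (w + w') = quad_poly w + quad_poly w'.
Proof. by rewrite /quad_poly map_mxD qformDl. Qed.

Lemma quad_poly0 : quad_poly 0 = 0.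
Proof. by rewrite /quad_poly map_mx0 qform0l. Qed.

Lemma quad_poly_inj w w' : quad_poly w = quad_poly w' -> w = w'.
Proof.
move=> E; apply/eqP; rewrite -subr_eq0; apply/eqP/qform_ext0 => x.
by rewrite qformDl -scaleN1r qformZl -!quad_poly_eval E mulN1r subrr.
Qed.

Lemma quad_poly_prod_form (l m : 'rV[k]_4) :
  quad_poly (prod_form l m) = linear_form l * linear_form m.
Proof.
rewrite /quad_poly map_prod_form qform_prod_form; congr (_ * _);
  by apply: eq_bigr => e _; rewrite !mxE mul_mpolyC.
Qed.

Lemma variable_homog m (i : 'I_m) : ('X_i : {mpoly k[m]}) \is 1.-homog.
Proof. by rewrite dhomogX; apply/eqP; exact: mdeg1. Qed.

Lemma quad_poly_homog w : quad_poly w \is 2.-homog.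
Proof.
rewrite /quad_poly qformE !mxE; do !apply: rpredD;
  by rewrite mul_mpolyC rpredZ // (dhomogM (variable_homog _) (variable_homog _)).
Qed.

Lemma is_quadric_quad_poly w : is_quadric (quad_poly w) <-> w != 0.
Proof.
split=> [[_]|w0]; first by apply: contraNneq => ->; rewrite quad_poly0.
split; first exact: quad_poly_homog.
by apply: contraNneq w0 => E; apply/eqP/quad_poly_inj; rewrite quad_poly0.
Qed.

(** A monomial of degree 2 is a product of two variables. *)
Lemma quadratic_quad_poly (q : {mpoly k[4]}) : q \is 2.-homog -> exists w, q = quad_poly w.
Proof.
move=> /dhomogP hq; rewrite (mpolyE q) big_seq.
apply: (big_ind (fun q => exists w, q = quad_poly w)).
- by exists 0; rewrite quad_poly0.
- by move=> _ _ [w ->] [w' ->]; exists (w + w'); rewrite quad_polyD.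
move=> m /hq md; suff [w ->] : exists w, 'X_[m] = quad_poly w by exists (q@_m *: w); rewrite quad_polyZ.
have [i [j ->]] : exists i j, m = (U_(i) + U_(j))%MM.
  have split1 (m' : 'X_{1..4}) d : mdeg m' = d.+1 ->
      exists i m'', m' = (U_(i) + m'')%MM /\ mdeg m'' = d.
    move=> E; have [i mi] : exists i, m' i != 0%N.
      apply: contrapT => nex; have : mdeg m' = 0%N.
        rewrite mdegE big1 // => i _; apply: contrapT => /eqP ne; apply: nex; by exists i.
      by rewrite E.
    have le : (U_(i) <= m')%MM.
      by apply/mnm_lepP => l; rewrite mnm1E; case: eqP => // <-; rewrite lt0n.
    exists i, (m' - U_(i))%MM; split; first by rewrite addmC submK.
    by apply: succn_inj; rewrite -E -{2}(submK le) mdegD mdeg1 addn1.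
  have [i [m1 [-> d1]]] := split1 m 1%N md.
  have [j [m2 [-> d2]]] := split1 m1 0%N d1.
  exists i, j; suff -> : m2 = 0%MM by rewrite addm0.
  by apply/eqP; rewrite -mdeg_eq0 d2.
exists (prod_form (delta_mx 0 i) (delta_mx 0 j)).
rewrite quad_poly_prod_form mpolyXD; congr (_ * _).
all: rewrite /linear_form; set l := (X in 'X_X).
all: by rewrite (bigD1 l) //= mxE !eqxx scale1r big1 ?addr0 // => e ne; rewrite mxE (negPf ne) scale0r.
Qed.

(** Twice the symmetric matrix of the quadratic form. *)
Definition polar_mx w : 'M[k]_4 := \matrix_(i, j) polar w (delta_mx 0 i) (delta_mx 0 j).

Lemma polar_mx_sym w : (polar_mx w)^T = polar_mx w.
Proof. by apply/matrixP => i j; rewrite !mxE polarC. Qed.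

Lemma polar_mxE w x y : polar w x y = (x *m polar_mx w *m y^T) 0 0.
Proof.
rewrite mxE {1}[y]row_sum_delta polar_sumr; apply: eq_bigr => j _.
rewrite polarZr polarC {1}[x]row_sum_delta polar_sumr mulrC !mxE; congr (_ * _).
by apply: eq_bigr => i _; rewrite polarZr mxE polarC.
Qed.

Lemma singular_for_mx w x : singular_for w x = (x *m polar_mx w == 0).
Proof.
apply/singular_forP/eqP => [h|h y]; last by rewrite polar_mxE h mul0mx mxE.
apply/rowP => j; rewrite [RHS]mxE -(h (delta_mx 0 j)) polar_mxE trmx_delta -colE.
by rewrite !mxE.
Qed.

Lemma singular_forZ w b x : b != 0 -> singular_for w (b *: x) = singular_for w x.
Proof. by move=> b0; rewrite !singular_for_mx -scalemxAl scaler_eq0 (negPf b0). Qed.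

Lemma mderiv_restrict m (g : {mpoly k[m]}) (x : 'rV[k]_m) i :
  g^`M(i).@[x 0] = (restrict_line (x 0) (delta_mx 0 i) g)`_1.
Proof.
rewrite restrict_line_coef1 (bigD1 i) //= mxE !eqxx mulr1 big1 ?addr0 // => j ne.
by rewrite mxE (negPf ne) mulr0.
Qed.

Lemma restrict_variables m (x v : 'rV[k]_m) :
  map_mx (restrict_line (x 0) v) (variables m) =
  1 *: map_mx polyC x + 'X *: map_mx polyC v.
Proof. by apply/rowP => i; rewrite !mxE restrict_lineX mul1r. Qed.

Lemma quad_poly_deriv w x i : (quad_poly w)^`M(i).@[x 0] = polar w x (delta_mx 0 i).
Proof.
rewrite mderiv_restrict /quad_poly map_qform restrict_variables.
have -> : map_mx (restrict_line (x 0) (delta_mx 0 i)) (map_mx (@mpolyC 4 k) w) = map_mx polyC w.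
  by apply/rowP => r; rewrite !mxE restrict_lineC.
rewrite qform_comb -!map_qform -map_polar expr1n !mul1r.
by rewrite !coefD coefC coefXM coefC coefXnM /= add0r addr0.
Qed.

Hypothesis ch2 : 2%:R != 0 :> k.

Lemma singular_for_qform w x : singular_for w x -> qform w x = 0.
Proof.
move=> /singular_forP/(_ x); rewrite polarxx -mulr_natl => /eqP.
by rewrite mulf_eq0 (negPf ch2) => /eqP.
Qed.

(** The vanishing of the derivatives implies that of the form, by Euler's
relation, as 2 is invertible. *)
Lemma singular_point_quad_poly w x : singular_point (quad_poly w) x = singular_for w x.
Proof.
rewrite /singular_point quad_poly_eval.
have -> : [forall i, (quad_poly w)^`M(i).@[x 0] == 0] = singular_for w x.
  by apply: eq_forallb => i; rewrite quad_poly_deriv.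
by apply: andb_idl => /singular_for_qform ->.
Qed.

Lemma polar_mx_eq0 w : polar_mx w = 0 -> w = 0.
Proof.
move=> h; apply: qform_ext0 => x; apply: singular_for_qform.
by rewrite singular_for_mx h mulmx0.
Qed.

End QuadricPolynomials.

Section SymmetricForms.
Variables (k : fieldType) (m : nat).

Definition sform (S : 'M[k]_m) : {mpoly k[m]} :=
  (variables k m *m map_mx (@mpolyC m k) S *m (variables k m)^T) 0 0.

Lemma map_sform (T : comNzRingType) (f : {rmorphism {mpoly k[m]} -> T}) S :
  f (sform S) = (map_mx f (variables k m) *m map_mx (f \o @mpolyC m k) S
                 *m (map_mx f (variables k m))^T) 0 0.
Proof.
have -> : map_mx (f \o @mpolyC m k) S = map_mx f (map_mx (@mpolyC m k) S).
  by apply/matrixP => i j; rewrite !mxE.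
by rewrite map_trmx -!map_mxM [RHS]mxE.
Qed.

Lemma sform_homog S : sform S \is 2.-homog.
Proof.
rewrite /sform mxE rpred_sum // => j _.
apply: (@dhomogM _ _ _ 1 _ 1); last by rewrite !mxE variable_homog.
rewrite mxE rpred_sum // => i _; rewrite !mxE mulrC mul_mpolyC rpredZ //.
exact: variable_homog.
Qed.

Lemma sform_deriv S (x : 'rV[k]_m) i :
  (sform S)^`M(i).@[x 0] = (x *m (S + S^T)) 0 i.
Proof.
rewrite mderiv_restrict map_sform restrict_variables.
set v := delta_mx 0 i.
have -> : map_mx (restrict_line (x 0) v \o @mpolyC m k) S = map_mx polyC S.
  by apply/matrixP => a b; rewrite !mxE /= restrict_lineC.
rewrite scale1r linearD /= linearZ /= mulmxDl !mulmxDr !mulmxDl.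
rewrite -!scalemxAl -!scalemxAr !map_trmx -!map_mxM.
have coef1 (M0 M1 M2 M3 : 'M[k]_1) :
    (((map_mx polyC M0 + 'X *: map_mx polyC M1 +
       ('X *: map_mx polyC M2 + 'X *: ('X *: map_mx polyC M3)))
      : 'M[{poly k}]_1) 0 0)`_1 = M1 0 0 + M2 0 0.
  by rewrite !mxE !coefD !coefXM !coefC /= addr0 add0r.
rewrite coef1 [RHS]mxE addrC; congr (_ + _).
  by rewrite /v -rowE !mxE; apply: eq_bigr => j _; rewrite !mxE mulrC.
by rewrite /v trmx_delta -colE mxE.
Qed.

End SymmetricForms.

(** * Quadrics of rank four, three and two *)
Section Extension.
Variables (k K : fieldType) (iota : {rmorphism k -> K}).

Lemma map_variables m : map_mx (map_mpoly iota) (variables k m) = variables K m.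
Proof. by apply/rowP => i; rewrite !mxE; exact: map_mpolyX. Qed.

Lemma map_mpoly_quad_poly w : map_mpoly iota (quad_poly w) = quad_poly (map_mx iota w).
Proof.
rewrite /quad_poly map_qform map_variables; congr (qform _ _).
by apply/rowP => r; rewrite !mxE; exact: map_mpolyC.
Qed.

Lemma map_mpoly_sform m (S : 'M[k]_m) : map_mpoly iota (sform S) = sform (map_mx iota S).
Proof.
have E : map_mx (map_mpoly iota \o @mpolyC m k) S = map_mx (@mpolyC m K) (map_mx iota S).
  by apply/matrixP => i j; rewrite !mxE /=; exact: map_mpolyC.
apply: etrans (map_sform _ S) _.
by rewrite map_variables E.
Qed.

Lemma map_polar_mx w : polar_mx (map_mx iota w) = map_mx iota (polar_mx w).
Proof. by apply/matrixP => i j; rewrite !mxE map_polar !map_delta_mx. Qed.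
End Extension.

Section Cones.
Variables (k : fieldType) (ch2 : 2%:R != 0 :> k).
Implicit Types (w : 'rV[k]_10).

Lemma smooth_of_unit w : polar_mx w \in unitmx -> smooth_hypersurface (quad_poly w).
Proof.
move=> U K iota x x0; rewrite map_mpoly_quad_poly singular_point_quad_poly; last first.
  by rewrite -(rmorph_nat iota) fmorph_eq0.
rewrite singular_for_mx map_polar_mx.
apply: contraNneq x0 => xH; have U' : map_mx iota (polar_mx w) \in unitmx by rewrite map_unitmx.
by rewrite -(mulmxK U' x) xH mul0mx.
Qed.

Lemma smooth_sform m (C : 'M[k]_m) : C^T = C -> C \in unitmx ->
  smooth_hypersurface (sform (2%:R^-1 *: C)).
Proof.
move=> Csym CU K iota x x0; rewrite map_mpoly_sform; apply/negP => /andP[_ /forallP h].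
have CU' : map_mx iota C \in unitmx by rewrite map_unitmx.
move/negP: x0; apply; rewrite -(mulmxK CU' x) (_ : x *m _ = 0) ?mul0mx //.
apply/rowP => i; rewrite [RHS]mxE.
have := eqP (h i); rewrite sform_deriv.
suff -> : map_mx iota (2%:R^-1 *: C) + (map_mx iota (2%:R^-1 *: C))^T = map_mx iota C by [].
rewrite map_trmx -map_mxD linearZ /= Csym -scalerDl -[_ + _]mulr2n -[_ *+ 2]mulr_natl.
by rewrite divff // scale1r.
Qed.

Lemma meval_sform m (S : 'M[k]_m) (x : 'rV_m) : (sform S).@[x 0] = (x *m S *m x^T) 0 0.
Proof.
apply: etrans (map_sform (meval (x 0)) S) _.
have -> : map_mx (meval (x 0)) (variables k m) = x.
  by apply/rowP => i; rewrite !mxE /= mevalXU.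
congr ((_ *m _ *m _) _ _); apply/matrixP => i j; by rewrite mxE /= mevalC.
Qed.

Lemma quad_poly_sform w : quad_poly w = sform (2%:R^-1 *: polar_mx w).
Proof.
have [w' E] := quadratic_quad_poly (sform_homog (2%:R^-1 *: polar_mx w)).
rewrite E; congr (quad_poly _); apply/eqP; rewrite -subr_eq0; apply/eqP/qform_ext0 => x.
rewrite qformDl -scaleN1r qformZl -(quad_poly_eval w') -E meval_sform.
rewrite -scalemxAr -scalemxAl mxE -polar_mxE polarxx -(mulr_natl (qform w x) 2) mulKf //.
by rewrite mulN1r subrr.
Qed.

Lemma sform_comp m (S : 'M[k]_m) (L : 'M[k]_(m, 4)) :
  sform S \mPo [tuple linear_form (row i L) | i < m] = sform (L^T *m S *m L).
Proof.
set lq := [tuple _ | i < m].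
apply: etrans (map_sform (comp_mpoly lq) S) _.
have -> : map_mx (comp_mpoly lq) (variables k m) = variables k 4 *m map_mx (@mpolyC 4 k) L^T.
  apply/rowP => i; rewrite !mxE comp_mpolyXU -tnth_nth tnth_mktuple /linear_form.
  by apply: eq_bigr => e _; rewrite !mxE mulrC mul_mpolyC.
have -> : map_mx (comp_mpoly lq \o @mpolyC m k) S = map_mx (@mpolyC 4 k) S.
  by apply/matrixP => i j; rewrite !mxE /= comp_mpolyC.
rewrite trmx_mul map_trmx trmxK /sform !map_mxM !mulmxA.
by [].
Qed.

(** Three independent linear forms [L] span the row space of the symmetric matrix,
which can then be written [L^T *m C *m L] with [C] symmetric and invertible. *)
Lemma cone_of_rank3 w : \rank (polar_mx w) = 3%N -> quadric_cone (quad_poly w).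
Proof.
move=> rk; set H := polar_mx w; have Hsym : H^T = H := polar_mx_sym w.
have [L [Lfree LH]] : exists L : 'M[k]_(3, 4), row_free L /\ (H <= L)%MS.
  move: (row_base H) (row_base_free H) (eq_row_base H); rewrite rk => L Lf LH.
  by exists L; rewrite LH.
have [R HRL] : exists R, H *m R *m L = H by exists (pinvmx L); exact: mulmxKpV.
pose C := R^T *m H *m R.
have LRH : L^T *m R^T *m H = H.
  apply: trmx_inj; rewrite !trmx_mul !trmxK Hsym mulmxA; exact: HRL.
have HC : L^T *m C *m L = H.
  by rewrite /C !mulmxA LRH HRL.
have Csym : C^T = C by rewrite /C !trmx_mul trmxK Hsym mulmxA.
have CU : C \in unitmx.
  rewrite -row_full_unit /row_full eqn_leq rank_leq_col -{1}rk -/H -HC.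
  by rewrite -mulmxA (leq_trans (mxrankM_maxr _ _)) ?mxrankM_maxl.
have E : quad_poly w = sform (2%:R^-1 *: C) \mPo [tuple linear_form (row i L) | i < 3].
  by rewrite sform_comp -scalemxAr -scalemxAl HC quad_poly_sform.
exists (sform (2%:R^-1 *: C)), L; split=> //; last exact: smooth_sform.
split; first exact: sform_homog.
apply/eqP => b0; move: E; rewrite b0 comp_mpoly0 -(quad_poly0 k) => /quad_poly_inj w0.
move: rk; rewrite w0 (_ : polar_mx 0 = 0) ?mxrank0 //.
by apply/matrixP => i j; rewrite !mxE /polar !qform0l !subr0.
Qed.

End Cones.

Section SplitQuadrics.
Variables (k : fieldType) (w : 'rV[k]_10) (y : 'rV[k]_4).
Hypotheses (ch2 : 2%:R != 0 :> k) (qy : qform w y = 0) (yns : ~~ singular_for w y).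
(** [l] is the equation of the tangent plane at the smooth point [y]. *)
Let H := polar_mx w.
Let l := y *m H.

Lemma lin_dot (u x : 'rV[k]_4) : lin u x = (u *m x^T) 0 0.
Proof. by rewrite mxE; apply: eq_bigr => e _; rewrite mxE. Qed.

Lemma lin_polar u x : lin (u *m H) x = polar w u x.
Proof. by rewrite lin_dot polar_mxE. Qed.

Lemma polar_dual : exists z, polar w y z = 1.
Proof.
have l0 : l != 0 by rewrite -singular_for_mx.
have [z lz] := lin_neq0 l0; exists ((lin l z)^-1 *: z).
by rewrite polarZr -lin_polar mulVf.
Qed.

Lemma tangent_pair_free z : polar w y z = 1 -> row_free (col_mx l (z *m H)).
Proof.
move=> yz; apply: inj_row_free => x.
rewrite -[x]hsubmxK mul_row_col => E.
have [a Ea] : exists a, lsubmx x = a%:M by exists (lsubmx x 0 0); exact: mx11_scalar.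
have [b Eb] : exists b, rsubmx x = b%:M by exists (rsubmx x 0 0); exact: mx11_scalar.
move: E; rewrite Ea Eb !mul_scalar_mx => E.
have lE v : lin (a *: l + b *: (z *m H)) v = a * polar w y v + b * polar w z v.
  by rewrite linDl !linZl !lin_polar.
have lin0 v : lin 0 v = 0 :> k by rewrite linE !mxE; ring.
have b0 : b = 0.
  by have := lE y; rewrite E lin0 polarxx qy mul0rn mulr0 add0r polarC yz mulr1.
have a0 : a = 0.
  by have := lE z; rewrite E lin0 yz b0 mul0r addr0 mulr1.
by rewrite a0 b0 raddf0 row_mx0.
Qed.

(** The tangent form at [y] and the polar form of a point outside the tangent plane
are linearly independent. *)
Lemma rank_polar_ge2 : (2 <= \rank H)%N.
Proof.
have [z yz] := polar_dual; have /eqP fr := tangent_pair_free yz.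
apply: (@leq_trans (\rank (col_mx l (z *m H)))); first by rewrite fr.
by rewrite mxrankS // col_mx_sub !submxMl.
Qed.

(** In rank 2 the tangent form [l] and the polar form of [z] span the row space of
the symmetric matrix.  Expressing the polar form of [x] in terms of them shows
that the quadratic form is divisible by [l]: a rank 2 quadric with a rational
smooth point contains the tangent plane there. *)
Lemma split_of_rank2 : \rank H = 2%N -> two_distinct_planes (quad_poly w).
Proof.
move=> rk; have [z yz] := polar_dual; have fr := tangent_pair_free yz.
have HM : (H <= col_mx l (z *m H))%MS.
  have sub : (col_mx l (z *m H) <= H)%MS by rewrite col_mx_sub !submxMl.
  by have [_ <-] := mxrank_leqif_sup sub; rewrite rk.
pose v := z *m H - qform w z *: l.
have vE x : lin v x = polar w z x - qform w z * polar w y x.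
  by rewrite /v linDl -scaleNr linZl !lin_polar mulNr.
have yy : polar w y y = 0 by rewrite polarxx qy mul0rn.
have zy : polar w z y = 1 by rewrite polarC.
have zz : polar w z z = qform w z *+ 2 by rewrite polarxx.
have wE : w = prod_form l v.
  apply/eqP; rewrite -subr_eq0; apply/eqP/qform_ext0 => x.
  rewrite qformDl -scaleN1r qformZl qform_prod_form vE lin_polar.
  have /submxP[X xH] : (x *m H <= col_mx l (z *m H))%MS by apply: submx_trans (submxMl _ _) HM.
  have [a Ea] : exists a, lsubmx (X : 'rV_(1 + 1)) = a%:M by exists (lsubmx X 0 0); exact: mx11_scalar.
  have [b Eb] : exists b, rsubmx (X : 'rV_(1 + 1)) = b%:M by exists (rsubmx X 0 0); exact: mx11_scalar.
  have pE u : polar w x u = a * polar w y u + b * polar w z u.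
    rewrite -lin_polar xH -[X]hsubmxK mul_row_col Ea Eb !mul_scalar_mx.
    by rewrite linDl !linZl !lin_polar.
  have bE : b = polar w y x by rewrite polarC pE yy zy; ring.
  have aE : a = polar w z x - qform w z *+ 2 * polar w y x.
    by rewrite [polar w z x]polarC pE [polar w y z]polarC zy zz -bE; ring.
  have q2 : qform w x *+ 2 = (polar w y x * (polar w z x - qform w z * polar w y x)) *+ 2.
    by rewrite -polarxx pE aE -bE; ring.
  apply: (mulfI ch2); rewrite mulr0 mulrDr mulN1r mulrN !mulr_natl q2 subrr //.
exists l, v; split.
- by rewrite -singular_for_mx.
- apply/eqP => v0; have := vE y; rewrite v0 yy zy linE !mxE => /eqP.
  by rewrite mulr0 subr0 !mul0r !addr0 eq_sym oner_eq0.
- apply/negP => /andP[/sub_rVP[a la] _].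
  have := lin_polar y y; rewrite -/l la linZl vE yy zy mulr0 subr0 mulr1 => a0.
  by move: yns; rewrite singular_for_mx -/H -/l la a0 scale0r eqxx.
- by rewrite {1}wE quad_poly_prod_form.
Qed.
End SplitQuadrics.

(** * Singular entries *)
Section Entries.
Variables (k : fieldType) (n : nat).
Implicit Types (w : 'rV[k]_10) (z : 'I_n -> 'rV[k]_4).

Definition only_quadric w z :=
  forall w', (forall i, qform w' (z i) = 0) -> (w' <= w)%MS.

Lemma only_quadric_rank w z : w != 0 -> (forall i, qform w (z i) = 0) ->
  only_quadric w z <-> \rank (veronese_mx z) = 9%N.
Proof.
move=> w0 wz; have /left_kernelP wV := wz; split=> [uniq|rk w' /left_kernelP w'V].
  have sub : (w <= kermx (veronese_mx z))%MS by apply/sub_kermxP.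
  have : (kermx (veronese_mx z) <= w)%MS.
    by apply/rV_subP => w' /sub_kermxP/left_kernelP/uniq.
  have [_ <-] := mxrank_leqif_sup sub; rewrite rank_rV w0 mxrank_ker.
  have := rank_leq_row (veronese_mx z); move=> ? /eqP; lia.
by apply: submx_trans (sub_rank1 w0 wV rk); apply/sub_kermxP.
Qed.

Hypothesis ch2 : 2%:R != 0 :> k.

Definition sing_indep w z := forall u : 'I_n -> k,
  (forall j, ~~ singular_for w (z j) -> u j = 0) ->
  \sum_j u j *: qv (z j) = 0 -> forall j, u j = 0.

(** If all entries are singular, a nonzero row of the symmetric matrix is a linear
form vanishing at all of them. *)
Lemma exists_nonsingular w z : w != 0 -> only_quadric w z ->
  exists i, ~~ singular_for w (z i).
Proof.
move=> w0 uniq; apply: contrapT => nex.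
have sing i : singular_for w (z i) by apply: contrapT => /negP ns; apply: nex; exists i.
have [e le] : exists e, row e (polar_mx w) != 0.
  apply: contrapT => nex'; move/eqP: w0; apply; apply: (polar_mx_eq0 ch2).
  apply/row_matrixP => e; rewrite row0; apply: contrapT => /eqP ne; apply: nex'.
  by exists e.
apply: (prod_form_not_prop le) => m; apply: uniq => i.
rewrite qform_prod_form rowE lin_polar polarC.
by have /singular_forP -> := sing i; rewrite mul0r.
Qed.

(** Equal points have proportional columns. *)
Lemma sing_indep_neq w z i j b : sing_indep w z -> singular_for w (z i) ->
  singular_for w (z j) -> z j = b *: z i -> i = j.
Proof.
move=> ind si sj zj; apply: contrapT => /eqP ij.
pose u l := (l == j)%:R - b ^+ 2 * (l == i)%:R : k.
have /ind/(_ _ j) : forall l, ~~ singular_for w (z l) -> u l = 0.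
  move=> l nsl; rewrite /u.
  have -> : (l == j) = false by apply: contraNF nsl => /eqP ->.
  have -> : (l == i) = false by apply: contraNF nsl => /eqP ->.
  by rewrite mulr0 subr0.
rewrite /u eqxx eq_sym (negPf ij) mulr0 subr0 => h.
suff /h E : \sum_l u l *: qv (z l) = 0 by move: (oner_neq0 k); rewrite -[1]/(true%:R) E eqxx.
rewrite /u {h}.
under eq_bigr => l _ do rewrite scalerBl.
rewrite sumrB (bigD1 j) //= big1 ?addr0 => [|l ne]; last by rewrite (negPf ne) scale0r.
rewrite (bigD1 i) //= [X in _ - (_ + X)]big1 ?addr0 => [|l ne].
  by rewrite !eqxx scale1r mulr1 zj qvZ subrr.
by rewrite (negPf ne) mulr0 scale0r.
Qed.

Lemma card_sing_rank3 w z : (forall i, z i != 0) -> sing_indep w z ->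
  \rank (polar_mx w) = 3%N -> (#|[set i | singular_for w (z i)]| <= 1)%N.
Proof.
move=> z0 ind rk; rewrite leqNgt; apply/negP => /card_gt1P[i [j []]].
rewrite !inE => si sj ij.
have rK : \rank (kermx (polar_mx w)) = 1%N by rewrite mxrank_ker rk.
have sub : (z i <= kermx (polar_mx w))%MS by apply/sub_kermxP/eqP; rewrite -singular_for_mx.
have /sub_rVP[b zj] : (z j <= z i)%MS.
  apply: submx_trans (_ : kermx (polar_mx w) <= z i)%MS.
    by apply/sub_kermxP/eqP; rewrite -singular_for_mx.
  by have [_ <-] := mxrank_leqif_sup sub; rewrite rK rank_rV z0.
by move/eqP: ij; apply; apply: sing_indep_neq ind si sj zj.
Qed.

Lemma qv_comb (x y : 'rV[k]_4) : exists q1 : 'cV_10,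
  forall a b : k, qv (a *: x + b *: y) = a ^+ 2 *: qv x + a * b *: q1 + b ^+ 2 *: qv y.
Proof.
exists (velocity x y) => a b; apply/colP => r.
by rewrite -qform_delta qform_comb !qform_delta !mxE.
Qed.

(** On the singular line the quadratic monomials lie in a space of dimension 3,
spanned by the squares and the product of two coordinates of the line, so any
four points satisfy a linear relation. *)
Lemma card_sing_rank2 w z : sing_indep w z ->
  \rank (polar_mx w) = 2%N -> (#|[set i | singular_for w (z i)]| <= 3)%N.
Proof.
move=> ind rk; set S := [set i | _]; rewrite leqNgt; apply/negP => lt.
pose f (b : 'I_4) : 'I_n := enum_val (widen_ord lt b).
have f_inj : injective f by move=> b b' /enum_val_inj/(congr1 val)/= /val_inj.
have fS b : singular_for w (z (f b)) by have := enum_valP (widen_ord lt b); rewrite inE.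
have [B BK] : exists B : 'M[k]_(2, 4), (kermx (polar_mx w) <= B)%MS.
  have rK : \rank (kermx (polar_mx w)) = 2%N by rewrite mxrank_ker rk.
  by move: (row_base _) (eq_row_base (kermx (polar_mx w))); rewrite rK => B BE; exists B; rewrite BE.
have coord b : exists y : 'rV_2, z (f b) = y *m B.
  by apply/submxP/(submx_trans _ BK)/sub_kermxP/eqP; rewrite -singular_for_mx.
have [y yE] := choice coord.
have zE b : z (f b) = y b 0 0 *: row 0 B + y b 0 1 *: row 1 B.
  rewrite yE mulmx_sum_row big_ord_recl big_ord1.
  by rewrite (_ : lift ord0 ord0 = 1) //; apply: val_inj.
have [q1 qE] := qv_comb (row 0 B) (row 1 B).
pose M : 'M[k]_(4, 3) := \matrix_(b, e) [tuple y b 0 0 ^+ 2; y b 0 0 * y b 0 1; y b 0 1 ^+ 2]`_e.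
have /rowV0Pn[x /sub_kermxP xM x0] : kermx M != 0.
  rewrite -mxrank_eq0 mxrank_ker subn_eq0 -ltnNge.
  exact: leq_ltn_trans (rank_leq_col _) _.
have xM' e : \sum_b x 0 b * M b e = 0 by move/rowP/(_ e): xM; rewrite !mxE.
pose u l := \sum_(b | f b == l) x 0 b.
have uf b : u (f b) = x 0 b by rewrite /u (big_pred1 b) // => b'; exact: inj_eq.
move/eqP: x0; apply; apply/rowP => b; rewrite mxE -uf; apply: ind.
  move=> l nsl; rewrite /u big_pred0 // => b'.
  by apply: contraNF nsl => /eqP <-.
transitivity (\sum_b x 0 b *: qv (z (f b))).
  rewrite /u; under eq_bigr => l _ do rewrite scaler_suml.
  rewrite (exchange_big_dep predT) //=; apply: eq_bigr => b' _.
  by rewrite (big_pred1 (f b')) // => l; rewrite eq_sym.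
under eq_bigr => b' _ do rewrite zE qE !scalerDr !scalerA.
rewrite !big_split /= -!scaler_suml.
have -> : \sum_b x 0 b * y b 0 0 ^+ 2 = 0 by rewrite -[RHS](xM' 0); apply: eq_bigr => b' _; rewrite mxE.
have -> : \sum_b x 0 b * (y b 0 0 * y b 0 1) = 0 by rewrite -[RHS](xM' 1); apply: eq_bigr => b' _; rewrite mxE.
have -> : \sum_b x 0 b * y b 0 1 ^+ 2 = 0 by rewrite -[RHS](xM' 2%:R); apply: eq_bigr => b' _; rewrite mxE.
by rewrite !scale0r !addr0.
Qed.

Lemma separating_lin (x y : 'rV[k]_4) : x != 0 -> y != 0 -> ~~ same_point x y ->
  exists2 l : 'rV_4, lin l y = 0 & lin l x != 0.
Proof.
move=> x0 y0 xy; have : ~~ (x <= y)%MS.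
  apply: contra xy => xy; rewrite /same_point xy /=.
  by have [_ <-] := mxrank_leqif_sup xy; rewrite !rank_rV x0 y0.
rewrite submxE => /rV0Pn[e xe]; exists (row e (cokermx y)^T).
  rewrite lin_dot -row_mul -trmx_mul mulmx_coker trmx0 !mxE //.
by rewrite lin_dot -row_mul -trmx_mul !mxE; move: xe; rewrite mxE.
Qed.

(** At most three distinct points, in any position: a product of two linear forms
vanishes at the others but not at a given one. *)
Lemma few_sing_indep w z : (forall i, z i != 0) ->
  (#|[set i | singular_for w (z i)]| <= 3)%N ->
  {in [set i | singular_for w (z i)] &, forall i j, same_point (z i) (z j) -> i = j} ->
  sing_indep w z.
Proof.
move=> z0; set S := [set i | _] => cardS dist u uS usum i.
have [iS|iS] := boolP (i \in S); last by apply: uS; move: iS; rewrite inE.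
have sep j : j \in S -> j != i -> exists2 l, lin l (z j) = 0 & lin l (z i) != 0.
  move=> jS ne; apply: separating_lin => //; apply: contra ne => e.
  by rewrite eq_sym; apply/eqP/dist.
have [[l m] [li mi lm]] : exists lm : 'rV[k]_4 * 'rV[k]_4,
    [/\ lin lm.1 (z i) != 0, lin lm.2 (z i) != 0 &
      forall j, j \in S -> j != i -> lin lm.1 (z j) * lin lm.2 (z j) = 0].
  have [e ze] : exists e, z i 0 e != 0 by apply/rV0Pn.
  have le : lin (delta_mx 0 e) (z i) != 0.
    rewrite /lin (bigD1 e) //= mxE !eqxx mul1r big1 ?addr0 // => e' ne.
    by rewrite mxE (negPf ne) mul0r.
  have := cardS; rewrite (cardsD1 i) iS add1n ltnS => card2.
  have memE j : (j \in enum (S :\ i)) = (j != i) && (j \in S) by rewrite mem_enum in_setD1.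
  have size2 : (size (enum (S :\ i)) <= 2)%N by rewrite -cardE.
  move: size2 memE; case: (enum (S :\ i)) => [|j1 [|j2 [|//]]] _ memE.
  - exists (delta_mx 0 e, delta_mx 0 e); split=> // j jS ji.
    by have := memE j; rewrite jS ji.
  - have /andP[n1 S1] : (j1 != i) && (j1 \in S) by rewrite -memE mem_head.
    have [l l1 li] := sep j1 S1 n1.
    exists (l, delta_mx 0 e); split=> // j jS ji.
    by have := memE j; rewrite jS ji inE => /eqP -> /=; rewrite l1 mul0r.
  - have /andP[n1 S1] : (j1 != i) && (j1 \in S) by rewrite -memE mem_head.
    have /andP[n2 S2] : (j2 != i) && (j2 \in S) by rewrite -memE !inE eqxx orbT.
    have [l l1 li] := sep j1 S1 n1; have [m m2 mi] := sep j2 S2 n2.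
    exists (l, m); split=> // j jS ji.
    have := memE j; rewrite jS ji !inE => /orP[] /eqP -> /=; first by rewrite l1 mul0r.
    by rewrite m2 mulr0.
have := congr1 (fun M : 'cV_10 => (prod_form l m *m M) 0 0) usum.
rewrite /= mulmx0 [RHS]mxE mulmx_sumr summxE (bigD1 i) //= big1 ?addr0 => [|j ji].
  rewrite -scalemxAr mxE -/(qform _ _) qform_prod_form => /eqP.
  by rewrite mulf_eq0 mulf_eq0 (negPf li) (negPf mi) !orbF => /eqP.
rewrite -scalemxAr mxE -/(qform _ _) qform_prod_form.
have [jS|jS] := boolP (j \in S); first by rewrite lm // mulr0.
by rewrite uS ?mul0r //; move: jS; rewrite inE.
Qed.

End Entries.

(** * The smoothness criterion *)
Section Main.
Variables (k : fieldType) (n : nat) (p : 'I_n -> 'rV[k]_4).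
Hypotheses (ch2 : 2%:R != 0 :> k) (hn : (10 <= n)%N).

Section Chart.
Variable c : 'I_n -> 'I_4.
Hypothesis pc : in_chart c p.
Local Notation a := (chart_coord c p).
Local Notation P := (chart_point c a).

Let PE i : P i = (p i 0 (c i))^-1 *: p i.
Proof. exact: chart_pointK. Qed.
Let pV i : (p i 0 (c i))^-1 != 0.
Proof. by rewrite invr_eq0 pc. Qed.

Lemma qform_chart w i : (qform w (P i) == 0) = (qform w (p i) == 0).
Proof. by rewrite PE qformZ mulf_eq0 expf_eq0 (negPf (pV i)). Qed.

Lemma only_quadric_chart w : only_quadric w P <-> only_quadric w p.
Proof.
by split=> h w' w'0; apply: h => i; apply/eqP; have /eqP := w'0 i; rewrite qform_chart.
Qed.

Lemma sing_indep_chart w : singular_independent c a w <-> sing_indep w p.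
Proof.
have sg j : singular_for w (P j) = singular_for w (p j) by rewrite PE singular_forZ.
have VE (u : 'cV[k]_n) : veronese_mx P *m u = \sum_j u j 0 *: qv (P j).
  apply/colP => r; rewrite mxE summxE; apply: eq_bigr => j _.
  by rewrite !mxE mulrC.
split=> [h u us usum j|h u us usum].
  pose u' : 'cV[k]_n := \col_j (u j * p j 0 (c j) ^+ 2).
  have : u' = 0.
    apply: h => [j' ns|]; first by rewrite mxE us ?mul0r // -sg.
    rewrite VE -[RHS]usum; apply: eq_bigr => j' _.
    by rewrite mxE PE qvZ scalerA exprVn mulfK // expf_neq0 ?pc.
  move/colP/(_ j)/eqP; rewrite !mxE mulf_eq0 expf_eq0 /=.
  by rewrite (negPf (pc j)) orbF => /eqP.
apply/colP => j; rewrite mxE.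
have /h : forall j, ~~ singular_for w (p j) -> u j 0 * (p j 0 (c j))^-1 ^+ 2 = 0.
  by move=> j'; rewrite -sg => /us ->; rewrite mul0r.
move=> /(_ _ j)/eqP; rewrite mulf_eq0 expf_eq0 /= (negPf (pV j)) orbF => E.
apply/eqP/E; rewrite -[RHS]usum VE; apply: eq_bigr => j' _.
by rewrite PE qvZ scalerA.
Qed.

Lemma smooth_chart w : w != 0 -> (forall i, qform w (p i) = 0) ->
  affine_smooth_at (X32_equations (k := k) c) a <-> only_quadric w p /\ sing_indep w p.
Proof.
move=> w0 wp; have wP i : qform w (P i) = 0 by apply/eqP; rewrite qform_chart wp.
rewrite -only_quadric_chart -sing_indep_chart (only_quadric_rank w0 wP).
by split=> [|[]]; [apply: smooth_rank9 | apply: rank9_smooth].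
Qed.
End Chart.

Hypothesis p0 : forall i, p i != 0.

Lemma smooth_iff w : w != 0 -> (forall i, qform w (p i) = 0) ->
  X32_smooth_at p <-> only_quadric w p /\ sing_indep w p.
Proof.
move=> w0 wp; split=> [[c pc]|h]; first exact: (proj1 (smooth_chart pc w0 wp)).
have [c pc] : exists c : 'I_n -> 'I_4, in_chart c p.
  have nz i : exists e, p i 0 e != 0 by apply/rV0Pn.
  by have [c pc] := choice nz; exists c.
by exists c => //; apply: (proj2 (smooth_chart pc w0 wp)).
Qed.

(** If V had rank 10, ten independent columns would give a nonzero minor. *)
Lemma in_X32_quadric : in_X32 p -> exists2 w, w != 0 & forall i, qform w (p i) = 0.
Proof.
move=> hX; have : kermx (veronese_mx p) != 0.
  rewrite kermx_eq0; apply/negP => /eqP rk.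
  have ind0 : independent_cols (veronese_mx p) set0.
    by move=> u u0 _; apply/colP => j; rewrite u0 ?inE // mxE.
  have [r [s [rE s_inj rs _]]] := extend_independent_cols ind0.
  move: s s_inj rs; rewrite rE rk => s s_inj rs.
  have := hX s s_inj; rewrite /maximal_minor => /eqP; apply/negP.
  by rewrite -unitfE -unitmxE -row_full_unit /row_full rs.
case/rowV0Pn => w /sub_kermxP/left_kernelP wp w0; by exists w.
Qed.

Lemma singular_entries_quad_poly w :
  singular_entries (quad_poly w) p = [set i | singular_for w (p i)].
Proof. by apply/setP => i; rewrite !inE singular_point_quad_poly. Qed.

Lemma only_quadric_poly w : w != 0 ->
  only_quadric w p <->
  (forall q', is_quadric q' -> through q' p -> same_hypersurface (quad_poly w) q').
Proof.
move=> w0; split=> h.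
  move=> q' q'Q; have [q'h _] := q'Q; have [w' E] := quadratic_quad_poly q'h; move: q'Q; rewrite E.
  move=> /is_quadric_quad_poly w'0 thr.
  have /h/sub_rVP[b w'E] : forall i, qform w' (p i) = 0.
    by move=> i; rewrite -quad_poly_eval; apply: thr.
  exists b; last by rewrite w'E quad_polyZ.
  by apply: contraNneq w'0 => b0; rewrite w'E b0 scale0r.
move=> w' w'p; have [->|w'0] := eqVneq w' 0; first exact: sub0mx.
have [|i|b _ E] := h (quad_poly w'); first exact/is_quadric_quad_poly.
  by rewrite quad_poly_eval.
by apply/sub_rVP; exists b; apply: quad_poly_inj; rewrite quad_polyZ.
Qed.

(** From left to right the rank of the symmetric matrix decides between the three
cases; from right to left the bounds on the singular entries make them
independent. *)
Lemma classification w : w != 0 -> (forall i, qform w (p i) = 0) -> only_quadric w p ->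
  sing_indep w p <->
  [\/ smooth_hypersurface (quad_poly w),
      quadric_cone (quad_poly w) /\ (#|singular_entries (quad_poly w) p| <= 1)%N
    | two_distinct_planes (quad_poly w) /\
      ((#|singular_entries (quad_poly w) p| <= 3)%N /\
       {in singular_entries (quad_poly w) p &,
          forall i j, same_point (p i) (p j) -> i = j})].
Proof.
move=> w0 wp uniq; rewrite singular_entries_quad_poly; split=> [ind|].
  have [i nsi] := exists_nonsingular ch2 w0 uniq.
  have ge2 := rank_polar_ge2 (wp i) nsi.
  have le4 := rank_leq_row (polar_mx w).
  have : [\/ \rank (polar_mx w) = 2%N, \rank (polar_mx w) = 3%N | \rank (polar_mx w) = 4%N].
    by move: ge2 le4; case: (\rank _) => [|[|[|[|[|r]]]]] // _ _;
      [constructor 1|constructor 2|constructor 3].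
  case=> rk.
  - constructor 3; split; first exact: (split_of_rank2 ch2 (wp i) nsi).
    split; first exact: card_sing_rank2.
    move=> j l; rewrite !inE => sj sl /andP[_ /sub_rVP[b E]].
    exact: sing_indep_neq ind sj sl E.
  - by constructor 2; split; [exact: cone_of_rank3 | exact: card_sing_rank3].
  - constructor 1; apply: smooth_of_unit => //.
    by rewrite -row_full_unit /row_full rk.
case=> [sm|[_ le1]|[_ [le3 dist]]].
- have S0 : [set i | singular_for w (p i)] = set0.
    apply/setP => i; rewrite !inE -singular_point_quad_poly //.
    apply/negbTE; have := sm k idfun (p i) (p0 i).
    by rewrite map_mpoly_quad_poly map_mx_id.
  by apply: few_sing_indep => //; rewrite S0 ?cards0 // => i; rewrite inE.
- apply: few_sing_indep => //; first exact: leq_trans le1 _.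
  by move=> i j iS jS _; apply: (card_le1_eqP le1).
- exact: few_sing_indep.
Qed.

End Main.

Theorem theorem5p4 (k : fieldType) (n : nat) (p : 'I_n -> 'rV[k]_4)
    (hn : ('C(3 + 2, 2) <= n)%N)
    (hchar : (2 \notin [pchar k])%N)
    (hp : forall i, p i != 0)
    (hX : in_X32 p) :
  X32_smooth_at p <->
  exists q : {mpoly k[4]},
    [/\ is_quadric q,
        through q p,
        (forall q', is_quadric q' -> through q' p -> same_hypersurface q q')
      & [\/ smooth_hypersurface q,
            quadric_cone q /\ (#|singular_entries q p| <= 1)%N
          | two_distinct_planes q /\
            ((#|singular_entries q p| <= 3)%N /\
             {in singular_entries q p &,
                forall i j, same_point (p i) (p j) -> i = j})]].
Proof.
have ch2 : 2%:R != 0 :> k by apply: contra hchar => h; rewrite inE h.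
split=> [sm|[q [qQ thr uniq cls]]].
  have [w w0 wp] := in_X32_quadric hX.
  have [uq ind] := proj1 (smooth_iff ch2 hn hp w0 wp) sm.
  exists (quad_poly w); split.
  - exact/is_quadric_quad_poly.
  - by move=> i; rewrite quad_poly_eval.
  - exact/only_quadric_poly.
  - exact/classification.
have [qh _] := qQ; have [w E] := quadratic_quad_poly qh; move: qQ thr uniq cls.
rewrite E => /is_quadric_quad_poly w0 thr uniq cls.
have wp i : qform w (p i) = 0 by rewrite -quad_poly_eval; apply: thr.
apply/(smooth_iff ch2 hn hp w0 wp).
have uq : only_quadric w p by apply/only_quadric_poly.
by split=> //; apply/classification.
Qed.
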